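(* Let $0 < \nu \le \frac12$ and $a > 0$, and let $R_{0,\nu}(a,t) = \mathcal{L}^{-1}\{e^{-a s^{\nu}};t\}$. Then $$R_{0,\nu}(a,t) = \frac{1}{\pi} \int_0^\infty e^{-t x}\, e^{-a \cos(\pi\nu)\, x^{\nu}} \sin\!\big(a \sin(\pi\nu)\, x^{\nu}\big)\, dx, \quad t > 0.$$
   Context: $\mathcal{L}\{y(t);s\} = \int_0^\infty e^{-st} y(t)\, dt$ denotes the Laplace transform and $\mathcal{L}^{-1}$ its inverse; $s^{\nu}$ is the principal branch. *)

(* Defs.v *)
From HB Require Import structures.
From mathcomp Require Import all_boot all_order all_algebra.
From mathcomp Require Import complex.
From mathcomp Require Import all_classical all_reals all_analysis.

Set Implicit Arguments.
Unset Strict Implicit.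
Unset Printing Implicit Defensive.

Import Order.TTheory GRing.Theory Num.Theory.
Import numFieldNormedType.Exports.

Local Open Scope classical_set_scope.
Local Open Scope ring_scope.
Local Open Scope complex_scope.

Section LaplaceTransform.
Context {R : realType}.

Definition cmod (z : R[i]) : R :=
  Num.sqrt (complex.Re z ^+ 2 + complex.Im z ^+ 2).

(* Principal argument, with values in ]-pi, pi] for z != 0. *)
Definition carg (z : R[i]) : R :=
  if 0 <= complex.Im z then acos (complex.Re z / cmod z)
  else - acos (complex.Re z / cmod z).

Definition cexp (z : R[i]) : R[i] :=
  (expR (complex.Re z))%:C * (cos (complex.Im z) +i* sin (complex.Im z)).

(* Principal branch of z ^ nu, i.e. |z| ^ nu * exp (i nu arg z). *)
Definition cpow (z : R[i]) (nu : R) : R[i] :=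
  (cmod z `^ nu)%:C * cexp (0 +i* (nu * carg z)).

Definition laplace_integrand (y : R -> R[i]) (s : R[i]) (t : R) : R[i] :=
  cexp (- (s * t%:C)) * y t.

Definition laplace_integrable (y : R -> R[i]) (s : R[i]) : Prop :=
  lebesgue_measure.-integrable `]0, +oo[
    (EFin \o (fun t => complex.Re (laplace_integrand y s t))) /\
  lebesgue_measure.-integrable `]0, +oo[
    (EFin \o (fun t => complex.Im (laplace_integrand y s t))).

Definition laplace (y : R -> R[i]) (s : R[i]) : R[i] :=
  (\int[lebesgue_measure]_(t in `]0, +oo[)
     complex.Re (laplace_integrand y s t)) +i*
  (\int[lebesgue_measure]_(t in `]0, +oo[)
     complex.Im (laplace_integrand y s t)).

(* The equation L{y; s} = F s on a right half-plane determines y on ]0, +oo[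
   only up to a null set; continuity on ]0, +oo[ makes it unique there. *)
Definition is_inverse_laplace (F : R[i] -> R[i]) (y : R -> R[i]) : Prop :=
  (forall t : R, 0 < t -> {for t, continuous (fun u => complex.Re (y u))} /\
                          {for t, continuous (fun u => complex.Im (y u))}) /\
  exists c : R, forall s : R[i], c < complex.Re s ->
    laplace_integrable y s /\ laplace y s = F s.

(* Only the values at t > 0 are meaningful.  If F has no inverse transform,
   the value is the zero function. *)
Definition inverse_laplace (F : R[i] -> R[i]) : R -> R[i] :=
  xget (fun=> 0) [set y | is_inverse_laplace F y].

Definition R0 (nu a t : R) : R[i] :=
  inverse_laplace (fun s => cexp (- (a%:C * cpow s nu))) t.

End LaplaceTransform.

(* Main.v *)
Require Import Defs.
From mathcomp Require Import all_boot all_order all_algebra.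
From mathcomp Require Import complex.
From mathcomp Require Import all_classical all_reals all_analysis.
From mathcomp Require Import measurable_realfun ring lra.

Import Order.TTheory GRing.Theory Num.Theory.
Import numFieldNormedType.Exports.

Set Implicit Arguments.
Unset Strict Implicit.
Unset Printing Implicit Defensive.

Local Open Scope classical_set_scope.
Local Open Scope ring_scope.
Local Open Scope complex_scope.

(* Let F(z) = exp(-a z^nu) and y(t) = 1/(2 pi i) int e^(tz) F(z) dz, the integral
   being taken along the imaginary axis, where F decays because nu <= 1/2; thus
   y is bounded and continuous.  For t > 0, turning the two half-lines by a
   quarter turn onto the negative real axis, where F takes the values
   exp(-a x^nu e^(+- i pi nu)) on the two sides of the cut, yields the formula of
   the theorem.  Keeping the imaginary axis makes the case nu = 1/2 no different
   from the others: on the cut itself F would not decay.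

   For Re s > 0 the Laplace transform of y is 1/(2 pi i) int F(z)/(s - z) dz.
   The two half-lines can be turned towards the ray through s, from either side,
   without changing their contributions; when the angle p between them and that
   ray tends to 0, the difference of the two kernels is 2i times a Poisson kernel
   of mass pi - p concentrating at s, which leaves F(s).

   No contour integration is needed: in polar coordinates the Cauchy-Riemann
   equations say that the theta-derivative of the integrand along the ray of
   angle theta is an exact r-derivative.

   Finally the continuous inverse transform is unique by Lerch's theorem. *)

(** * Complex functions of a real variable *)

(** The delicate point is the limit in which the two rays close onto the ray through s. The pole
    then lies on the limiting path, so neither Cauchy kernel has an integrable majorant near s that
    is uniform in p; and F(s) times a single kernel decays only like 1/r, so it is not integrable at
    infinity. For this reason F(s) is subtracted on both rays together. Near s the pole is cancelled
    by F(z) - F(s), which is bounded by a multiple of |z - s|. Far from s the decay of F and that of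
    the Poisson kernel take over. Both bounds are uniform in p, and dominated convergence applies to
    what is left.

    The majorants used for the ray integrals all have the form C / (1 + r^2), uniformly in the
    angle. Such a bound justifies differentiation under the integral sign and makes the boundary
    terms of the exact r-derivative vanish. In the right half-plane it comes from |F(z)| <= exp(-c
    |z|^nu) with c = a cos(pi/4), which beats every power of |z| however small nu is. *)

Section ComplexAlgebra.
Context {R : realType}.
Implicit Types (z w : R[i]) (x y th : R).

Lemma cReD z w : complex.Re (z + w) = complex.Re z + complex.Re w.
Proof. by case: z; case: w. Qed.
Lemma cImD z w : complex.Im (z + w) = complex.Im z + complex.Im w.
Proof. by case: z; case: w. Qed.
Lemma cReN z : complex.Re (- z) = - complex.Re z.
Proof. by case: z. Qed.
Lemma cImN z : complex.Im (- z) = - complex.Im z.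
Proof. by case: z. Qed.
Lemma cReM z w : complex.Re (z * w) =
  complex.Re z * complex.Re w - complex.Im z * complex.Im w.
Proof. by case: z; case: w. Qed.
Lemma cImM z w : complex.Im (z * w) =
  complex.Re z * complex.Im w + complex.Im z * complex.Re w.
Proof. by case: z; case: w. Qed.
Lemma cReRM x z : complex.Re (x%:C * z) = x * complex.Re z.
Proof. by rewrite cReM /= mul0r subr0. Qed.
Lemma cImRM x z : complex.Im (x%:C * z) = x * complex.Im z.
Proof. by rewrite cImM /= mul0r addr0. Qed.
Lemma cReV z : complex.Re z^-1 = complex.Re z / (complex.Re z ^+ 2 + complex.Im z ^+ 2).
Proof. by case: z. Qed.
Lemma cImV z : complex.Im z^-1 = - (complex.Im z / (complex.Re z ^+ 2 + complex.Im z ^+ 2)).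
Proof. by case: z. Qed.

Lemma complex_ext z w : complex.Re z = complex.Re w -> complex.Im z = complex.Im w -> z = w.
Proof. by case: z => a b; case: w => c d /= -> ->. Qed.

Lemma cmod_norm z : `|z| = (cmod z)%:C.
Proof. by case: z. Qed.

Lemma cmod_ge0 z : 0 <= cmod z. Proof. exact: sqrtr_ge0. Qed.

Lemma cmodM z w : cmod (z * w) = cmod z * cmod w.
Proof.
by apply: (@complexI R); rewrite rmorphM/= -!cmod_norm normrM.
Qed.
Lemma cmodV z : cmod z^-1 = (cmod z)^-1.
Proof.
by apply: (@complexI R); rewrite fmorphV/= -!cmod_norm normfV.
Qed.
Lemma cmodN z : cmod (- z) = cmod z.
Proof. by apply: (@complexI R); rewrite -!cmod_norm normrN. Qed.
Lemma cmodD z w : cmod (z + w) <= cmod z + cmod w.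
Proof. by rewrite -lecR rmorphD/= -!cmod_norm ler_normD. Qed.
Lemma cmod_real x : cmod x%:C = `|x|.
Proof. by rewrite /cmod /= expr0n/= addr0 sqrtr_sqr. Qed.
Lemma cmod_eq0 z : (cmod z == 0) = (z == 0).
Proof.
by rewrite -(inj_eq (@complexI R)) -cmod_norm (_ : 0%:C = 0)// normr_eq0.
Qed.
Lemma sqr_cmod z : cmod z ^+ 2 = complex.Re z ^+ 2 + complex.Im z ^+ 2.
Proof. by rewrite sqr_sqrtr// addr_ge0// sqr_ge0. Qed.
Lemma Re_le_cmod z : `|complex.Re z| <= cmod z.
Proof. by rewrite -sqrtr_sqr ler_wsqrtr// lerDl sqr_ge0. Qed.
Lemma Im_le_cmod z : `|complex.Im z| <= cmod z.
Proof. by rewrite -sqrtr_sqr ler_wsqrtr// lerDr sqr_ge0. Qed.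
Lemma cmod_le z : cmod z <= `|complex.Re z| + `|complex.Im z|.
Proof.
rewrite -(@ler_pXn2r _ 2)// ?nnegrE ?addr_ge0 ?cmod_ge0//.
rewrite sqr_cmod sqrrD !real_normK ?num_real//.
have := mulr_ge0 (normr_ge0 (complex.Re z)) (normr_ge0 (complex.Im z)); lra.
Qed.

Lemma cexpD z w : cexp (z + w) = cexp z * cexp w.
Proof.
by case: z => a b; case: w => c d; apply: complex_ext;
  rewrite /cexp /= expRD cosD sinD; ring.
Qed.
Lemma cmod_cexp z : cmod (cexp z) = expR (complex.Re z).
Proof.
rewrite /cexp cmodM cmod_real ger0_norm ?expR_ge0//.
by rewrite /cmod /= cos2Dsin2 sqrtr1 mulr1.
Qed.
Lemma cexp_neq0 z : cexp z != 0.
Proof. by rewrite -cmod_eq0 cmod_cexp gt_eqF ?expR_gt0. Qed.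

Definition cis th : R[i] := cos th +i* sin th.
Lemma cisE th : cis th = cos th +i* sin th. Proof. by []. Qed.
Lemma cexp_imag th : cexp (0 +i* th) = cis th.
Proof. by rewrite /cexp /= expR0 mul1r. Qed.
Lemma cmod_cis th : cmod (cis th) = 1.
Proof. by rewrite -cexp_imag cmod_cexp/= expR0. Qed.
Lemma cisD x y : cis (x + y) = cis x * cis y.
Proof. by apply: complex_ext; rewrite /= ?cosD ?sinD //; ring. Qed.

Definition cderive (f : R -> R[i]) x (df : R[i]) : Prop :=
  is_derive x 1 (fun u => complex.Re (f u)) (complex.Re df) /\
  is_derive x 1 (fun u => complex.Im (f u)) (complex.Im df).

Lemma is_derive_eqf (f g : R -> R) x df dg : is_derive x (1:R) f df ->
  f = g -> df = dg -> is_derive x (1:R) g dg.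
Proof. by move=> h <- <-. Qed.

Lemma cderive_eq f x df dg : cderive f x df -> df = dg -> cderive f x dg.
Proof. by move=> h <-. Qed.

Lemma cderive_cst z x : cderive (fun=> z) x 0.
Proof. by split; exact: is_derive_cst. Qed.

Lemma cderiveD f g x df dg : cderive f x df -> cderive g x dg ->
  cderive (fun u => f u + g u) x (df + dg).
Proof.
move=> [f1 f2] [g1 g2]; split.
  by apply: (is_derive_eqf (is_deriveD f1 g1));
    [apply/funext => u; rewrite cReD|rewrite cReD].
by apply: (is_derive_eqf (is_deriveD f2 g2));
    [apply/funext => u; rewrite cImD|rewrite cImD].
Qed.

Lemma cderiveM f g x df dg : cderive f x df -> cderive g x dg ->
  cderive (fun u => f u * g u) x (df * g x + f x * dg).
Proof.
move=> [f1 f2] [g1 g2]; split.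
  apply: (is_derive_eqf (is_deriveB (is_deriveM f1 g1) (is_deriveM f2 g2))).
    by apply/funext => u; rewrite cReM.
  by rewrite cReD !cReM /GRing.scale/=; ring.
apply: (is_derive_eqf (is_deriveD (is_deriveM f1 g2) (is_deriveM f2 g1))).
  by apply/funext => u; rewrite cImM.
by rewrite cImD !cImM /GRing.scale/=; ring.
Qed.

Lemma cderive_exp f x df : cderive f x df ->
  cderive (fun u => cexp (f u)) x (df * cexp (f x)).
Proof.
move=> [f1 f2].
have e1 := @is_derive1_comp _ _ _ _ _ _ (is_derive_expR _) f1.
have c1 := @is_derive1_comp _ _ _ _ _ _ (is_derive_cos _) f2.
have s1 := @is_derive1_comp _ _ _ _ _ _ (is_derive_sin _) f2.
split.
  apply: (is_derive_eqf (is_deriveM e1 c1)).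
    by apply/funext => u; rewrite cReRM.
  by rewrite cReM cReRM cImRM /GRing.scale/=; ring.
apply: (is_derive_eqf (is_deriveM e1 s1)).
  by apply/funext => u; rewrite cImRM.
by rewrite cImM cReRM cImRM /GRing.scale/=; ring.
Qed.

Lemma cderiveV f x df : f x != 0 -> cderive f x df ->
  cderive (fun u => (f u)^-1) x (- df / f x ^+ 2).
Proof.
move=> fx0 [f1 f2].
have N0 : complex.Re (f x) ^+ 2 + complex.Im (f x) ^+ 2 != 0.
  by rewrite -sqr_cmod sqrf_eq0 cmod_eq0.
have N := is_deriveD (is_deriveM f1 f1) (is_deriveM f2 f2).
have N1 : is_derive x (1:R) (fun u => complex.Re (f u) ^+2 + complex.Im (f u) ^+ 2)
     (2 * (complex.Re (f x) * complex.Re df + complex.Im (f x) * complex.Im df)).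
  by apply: (is_derive_eqf N) => //; rewrite /GRing.scale/=; ring.
have N' : is_derive x (1:R) (fun u => (complex.Re (f u) ^+2 + complex.Im (f u) ^+ 2)^-1)
   (- (complex.Re (f x) ^+ 2 + complex.Im (f x) ^+ 2) ^- 2 *
     (2 * (complex.Re (f x) * complex.Re df + complex.Im (f x) * complex.Im df))).
  case: N1 => d1 d2; split; first exact: derivableV.
  by rewrite deriveV// d2.
(* The inverse is the conjugate divided by the squared modulus. *)
have Nx : (f x)^-1 = (f x)^*%C * ((complex.Re (f x) ^+ 2 + complex.Im (f x) ^+ 2)^-1)%:C.
  by case: (f x) => a b /=; apply: complex_ext; rewrite /=; ring.
have -> : - df / f x ^+ 2 = - df * ((f x)^*%C ^+ 2) *
   ((complex.Re (f x) ^+ 2 + complex.Im (f x) ^+ 2)^- 2)%:C.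
  by rewrite -[in LHS]exprVn Nx exprMn mulrA -[in RHS]exprVn [in RHS]rmorphXn.
set n := _ ^- 2 in N' *.
(* Once the inverse squared modulus is written as [n] times the squared modulus, with [n] opaque,
   the remaining identities are polynomial. *)
have NN : (complex.Re (f x) ^+ 2 + complex.Im (f x) ^+ 2)^-1 = n * (complex.Re (f x) ^+ 2 + complex.Im (f x) ^+ 2).
  by rewrite /n expr2 invfM mulrAC mulVf// mul1r -?mulrA.
split.
  apply: (is_derive_eqf (is_deriveM f1 N')).
    by apply/funext => u; rewrite cReV.
  rewrite /GRing.scale/=.
  rewrite NN; move: (f x) df n {f1 f2 fx0 N0 N N1 N' Nx NN} => [a b] [c d] n; rewrite !exprS !expr0 !(cReM, cImM, cReN, cImN) /=. ring.
apply: (is_derive_eqf (is_deriveN (is_deriveM f2 N'))).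
  by apply/funext => u; rewrite cImV.
rewrite /GRing.scale/=.
rewrite NN; move: (f x) df n {f1 f2 fx0 N0 N N1 N' Nx NN} => [a b] [c d] n; rewrite !exprS !expr0 !(cReM, cImM, cReN, cImN) /=; ring.
Qed.

Lemma cderive_real (f : R -> R) x df : is_derive x 1 f df ->
  cderive (fun u => (f u)%:C) x df%:C.
Proof. by move=> h; split => //=; exact: is_derive_cst. Qed.

Lemma cderive_imag (f : R -> R) x df : is_derive x 1 f df ->
  cderive (fun u => 0 +i* f u) x (0 +i* df).
Proof. by move=> h; split => //=; exact: is_derive_cst. Qed.

Definition ccontinuous_at (f : R -> R[i]) x : Prop :=
  {for x, continuous (fun u => complex.Re (f u))} /\
  {for x, continuous (fun u => complex.Im (f u))}.

Lemma cderive_continuous f x df : cderive f x df -> ccontinuous_at f x.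
Proof.
by move=> [[d1 _] [d2 _]]; split; apply: differentiable_continuous;
   apply/derivable1_diffP.
Qed.

(* The Cauchy-Riemann equations in polar coordinates: F r th is the value at
   z = r e^(i th) of a function of z, and X r th that of z F'(z). *)
Definition phol (F X : R -> R -> R[i]) r th : Prop :=
  cderive (F r) th ('i * X r th) /\ cderive (F ^~ th) r (X r th / r%:C).

Lemma phol_eqX F X Y r th : phol F X r th -> X r th = Y r th -> phol F Y r th.
Proof. by rewrite /phol => h <-. Qed.

Lemma phol_cst z r th : phol (fun _ _ => z) (fun _ _ => 0) r th.
Proof.
by split; rewrite ?mulr0 ?mul0r; exact: cderive_cst.
Qed.

Lemma pholD F X G Y r th : phol F X r th -> phol G Y r th ->
  phol (fun r th => F r th + G r th) (fun r th => X r th + Y r th) r th.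
Proof.
move=> [f1 f2] [g1 g2]; split.
  by apply: cderive_eq (cderiveD f1 g1) _; rewrite mulrDr.
by apply: cderive_eq (cderiveD f2 g2) _; rewrite mulrDl.
Qed.

Lemma pholM F X G Y r th : phol F X r th -> phol G Y r th ->
  phol (fun r th => F r th * G r th)
       (fun r th => X r th * G r th + F r th * Y r th) r th.
Proof.
move=> [f1 f2] [g1 g2]; split.
  by apply: cderive_eq (cderiveM f1 g1) _; ring.
by apply: cderive_eq (cderiveM f2 g2) _; rewrite mulrDl; ring.
Qed.

Lemma phol_exp F X r th : phol F X r th ->
  phol (fun r th => cexp (F r th)) (fun r th => X r th * cexp (F r th)) r th.
Proof.
move=> [f1 f2]; split.
  by apply: cderive_eq (cderive_exp f1) _; rewrite [RHS]mulrA.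
by apply: cderive_eq (cderive_exp f2) _; rewrite [LHS]mulrAC.
Qed.

Lemma pholV F X r th : F r th != 0 -> phol F X r th ->
  phol (fun r th => (F r th)^-1) (fun r th => - X r th / F r th ^+ 2) r th.
Proof.
move=> F0 [f1 f2]; split.
  by apply: cderive_eq (cderiveV F0 f1) _; rewrite -mulrN mulrA.
by apply: cderive_eq (cderiveV F0 f2) _; rewrite [RHS]mulrAC !mulNr.
Qed.

(* The point z = r e^(i th) and the principal power z ^ nu (for |th| < pi). *)
Definition zpol (r th : R) : R[i] := r%:C * cis th.
Definition zpow (nu r th : R) : R[i] := (r `^ nu)%:C * cis (nu * th).

Lemma cderive_cis (k th : R) : cderive (fun u => cis (k * u)) th ('i * (k%:C * cis (k * th))).
Proof.
have d : is_derive th (1:R) (fun u => k * u) k.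
  by apply: is_derive_eqf (is_deriveZ k (is_derive_id th 1)) _ _ => //;
    rewrite /GRing.scale/= mulr1.
have := cderive_exp (cderive_imag d); under eq_fun do rewrite cexp_imag.
move=> h; apply: cderive_eq h _; rewrite cexp_imag [RHS]mulrA; congr (_ * _).
by apply: complex_ext; rewrite /=; ring.
Qed.

Lemma phol_zpol r th : r != 0 -> phol zpol zpol r th.
Proof.
move=> r0; split; rewrite /zpol.
  have := cderive_cis 1 th; under eq_fun do rewrite mul1r.
  move=> h; apply: cderive_eq (cderiveM (cderive_cst r%:C th) h) _.
  by rewrite mul0r add0r !mul1r; ring.
apply: cderive_eq (cderiveM (cderive_real (is_derive_id r 1)) (cderive_cst (cis th) r)) _.
rewrite /= mulr0 addr0 mul1r mulrAC divff ?mul1r//.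
by apply: contra r0 => /eqP [->].
Qed.

Lemma phol_zpow nu r th : 0 < r ->
  phol (zpow nu) (fun r th => nu%:C * zpow nu r th) r th.
Proof.
move=> r0; split; rewrite /zpow.
  apply: cderive_eq (cderiveM (cderive_cst (r `^ nu)%:C th) (cderive_cis nu th)) _.
  by rewrite mul0r add0r; ring.
have d := @is_derive1_powR R nu r r0.
apply: cderive_eq (cderiveM (cderive_real d) (cderive_cst (cis (nu * th)) r)) _.
have -> : r `^ (nu - 1) = r `^ nu / r.
  by rewrite powRB; [rewrite powRr1// ltW|rewrite (gt_eqF r0) implybT].
rewrite mulr0 addr0.
rewrite rmorphM/= rmorphM/= fmorphV.
by move: (cis _) => c; rewrite !mulrA [RHS]mulrAC.
Qed.

Lemma phol_zpolB (s : R[i]) r th : r != 0 ->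
  phol (fun r th => s - zpol r th) (fun r th => - zpol r th) r th.
Proof.
move=> r0; have := pholD (phol_cst s r th) (pholM (phol_cst (-1) r th) (phol_zpol th r0)).
have -> : (fun r th => s + -1 * zpol r th) = (fun r th => s - zpol r th).
  by apply/funext => u; apply/funext => v; rewrite mulN1r.
by move/phol_eqX; apply; rewrite mul0r !add0r mulN1r.
Qed.

Lemma phol_continuous F X r th : phol F X r th ->
  ccontinuous_at (F r) th /\ ccontinuous_at (F ^~ th) r.
Proof. by move=> [/cderive_continuous ? /cderive_continuous]. Qed.

End ComplexAlgebra.

(** * Integrals over the half-line *)

Section HalfLine.
Context {R : realType}.
Notation mu := (@lebesgue_measure R).
Notation RP := (`]0, +oo[%classic : set R).

(** The standard majorant on the half-line: it is integrable, and [r] times it tends to 0 at both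
    ends. *)
Definition cauchy_bd (C r : R) := C / (1 + r ^+ 2).

Lemma add1_sqr_gt0 (r : R) : 0 < 1 + r ^+ 2.
Proof. by rewrite ltr_pwDl// sqr_ge0. Qed.

Lemma measurable_halfline (f : R -> R) :
  (forall r, 0 < r -> {for r, continuous f}) -> measurable_fun RP f.
Proof.
move=> cf; apply: open_continuous_measurable_fun => //.
by move=> r; rewrite inE/= in_itv/= andbT => /cf.
Qed.

Lemma integrable_cauchy_bd C : mu.-integrable RP (EFin \o cauchy_bd C).
Proof.
suff h : mu.-integrable RP (EFin \o (fun r => (oneDsqr r)^-1)).
  rewrite (_ : EFin \o _ = (fun r : R => C%:E * ((oneDsqr r)^-1)%:E)%E); last first.
    by apply/funext => r /=; rewrite -EFinM.
  exact: integrableZl.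
suff h2 : mu.-integrable `[0, +oo[ (EFin \o (fun r => (oneDsqr r)^-1)).
  apply: integrableS h2 => //.
  by move=> r /=; rewrite !in_itv/= !andbT; exact: ltW.
apply/integrableP; split.
  apply/measurable_EFinP; apply: measurable_funTS.
  by apply: continuous_measurable_fun; exact: continuous_oneDsqrV.
under eq_integral => x _.
  rewrite /= ger0_norm; last by rewrite invr_ge0 ltW// add1_sqr_gt0.
  over.
by rewrite integral0y_oneDsqr ltry.
Qed.

Lemma integrable_halfline (f : R -> R) C :
  (forall r, 0 < r -> {for r, continuous f}) ->
  (forall r, 0 < r -> `|f r| <= cauchy_bd C r) ->
  mu.-integrable RP (EFin \o f).
Proof.
move=> cf fC; apply: le_integrable (integrable_cauchy_bd C) => //.
  by apply/measurable_EFinP; exact: measurable_halfline.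
move=> r /=; rewrite in_itv/= andbT => r0.
by rewrite lee_fin (le_trans (fC _ r0))// ler_norm.
Qed.

Lemma continuous_within_itv (f : R -> R) (a b : R) :
  (forall x, a <= x <= b -> {for x, continuous f}) -> {within `[a, b], continuous f}.
Proof.
move=> cf; apply: continuous_in_subspaceT => x.
by rewrite inE/= in_itv/=; exact: cf.
Qed.

Lemma FTC2_derive (F f : R -> R) (a b : R) : a < b ->
  (forall x, a <= x <= b -> is_derive x 1 F (f x)) ->
  (forall x, a <= x <= b -> {for x, continuous f}) ->
  \int[mu]_(x in `[a, b]) f x = F b - F a.
Proof.
move=> ab dF cf; rewrite /Rintegral (@continuous_FTC2 _ f F)//.
- exact: continuous_within_itv.
- have cF x : a <= x <= b -> {for x, continuous F}.
    move=> /dF[d _]; apply: differentiable_continuous; exact/derivable1_diffP.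
  split.
  + by move=> x; rewrite in_itv/= => /andP[ax xb]; have [|//] := dF x; rewrite !ltW.
  + by apply: cvg_at_right_filter; apply: cF; rewrite lexx ltW.
  + by apply: cvg_at_left_filter; apply: cF; rewrite lexx ltW.
- move=> x; rewrite in_itv/= => /andP[ax xb].
  by have [|d <-] := dF x; rewrite ?derive1E// !ltW.
Qed.

(* The boundary terms vanish because F is O(r) at 0 and O(1/r) at infinity. *)
Lemma integral_derive_halfline (F f : R -> R) (C : R) :
  (forall r : R, 0 < r -> is_derive r 1 F (f r)) ->
  (forall r, 0 < r -> {for r, continuous f}) ->
  (forall r, 0 < r -> `|f r| <= cauchy_bd C r) ->
  (forall r, 0 < r -> `|F r| <= r * cauchy_bd C r) ->
  \int[mu]_(r in `]0, +oo[) f r = 0.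
Proof.
move=> dF cf fC FC.
have C0 : 0 <= C.
  have := le_trans (normr_ge0 _) (fC 1 ltr01).
  by rewrite /cauchy_bd pmulr_lge0// invr_gt0 add1_sqr_gt0.
(* The shift by 2 makes a n < 1 < b n for every n, including n = 0. *)
pose a n : R := n.+2%:R^-1; pose b n : R := n.+2%:R.
have a0 n : 0 < a n by rewrite invr_gt0.
have ab n : a n < b n.
  by rewrite (@lt_trans _ _ 1)// /a /b ?invf_lt1 ?ltr1n.
pose f_ n := (f \_ `[a n, b n]).
have lim1 : (\int[mu]_(r in RP) (f_ n r)%:E)%E @[n --> \oo] -->
    (\int[mu]_(r in RP) (f r)%:E)%E.
  apply: (@dominated_cvg _ _ _ mu RP _ (fun n r => (f_ n r)%:E) (EFin \o f) (EFin \o cauchy_bd C)) => //.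
  - move=> n; apply/measurable_EFinP; apply/measurable_restrict => //.
    apply: measurable_funS (measurable_halfline cf) => //; exact: subIsetl.
  - move=> r; rewrite /= in_itv/= andbT => r0; apply: cvg_EFin; first exact: nearW.
    apply: cvg_near_cst; near=> n.
    rewrite /= /f_ /= patchE mem_set//= in_itv/=; apply/andP; split.
      rewrite /a invf_ple ?posrE// (le_trans (ltW (truncnS_gt _)))// ler_nat.
      by rewrite (@leq_trans n)//; last exact: leqW; near: n; exact: nbhs_infty_ge.
    rewrite /b (le_trans (ltW (truncnS_gt _)))// ler_nat.
    by rewrite (@leq_trans n)//; last exact: leqW; near: n; exact: nbhs_infty_ge.
  - exact: integrable_cauchy_bd.
  - move=> n r; rewrite /= in_itv/= andbT => r0; rewrite lee_fin /f_ patchE.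
    case: ifP => _; first exact: fC.
    by rewrite normr0 divr_ge0// ltW// add1_sqr_gt0.
have int_f n : \int[mu]_(r in RP) f_ n r = F (b n) - F (a n).
  transitivity (\int[mu]_(x in `[a n, b n]) f x).
    rewrite -Rintegral_mkcondr; congr (Rintegral _ _ _).
    apply/seteqP; split => r /=; rewrite !in_itv/= ?andbT; first by case.
    by move=> /andP[ra ->]; rewrite ra (lt_le_trans _ ra).
  apply: FTC2_derive => // r /andP[ra _].
    by apply: dF; rewrite (lt_le_trans _ ra).
  by apply: cf; rewrite (lt_le_trans _ ra).
have lim2 : (F (b n) - F (a n)) @[n --> \oo] --> (0 : R).
  (* Since a n = 1 / b n, the bound C r at the lower end and the bound C / r at the upper end are
     the same number. *)
  have key n : `|F (b n) - F (a n)| <= 2 * C * n.+1%:R^-1.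
    have h r : 0 < r -> r * cauchy_bd C r <= C * r /\ r * cauchy_bd C r <= C / r.
      move=> r0; have d0 := add1_sqr_gt0 r; rewrite /cauchy_bd; split.
        rewrite mulrA ler_pdivrMr//  [leLHS]mulrC ler_peMr ?mulr_ge0 ?(ltW r0)//.
        by rewrite lerDl sqr_ge0.
      rewrite ler_pdivlMr// [leLHS](_ : _ = C * (r ^+ 2 / (1 + r ^+ 2))); last by ring.
      by rewrite ler_piMr// ler_pdivrMr// mul1r lerDr.
    rewrite (le_trans (ler_normB _ _))//.
    have bn0 : 0 < b n by [].
    have := le_trans (FC _ bn0) (h _ bn0).2.
    have := le_trans (FC _ (a0 n)) (h _ (a0 n)).1.
    rewrite -/(a n) => h1 h2.
    apply: le_trans (lerD h2 h1) _; rewrite -/(a n) -mulr2n -[leLHS]mulr_natl mulrA.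
    by rewrite ler_wpM2l ?mulr_ge0// lef_pV2 ?posrE// ler_nat.
  apply/norm_cvg0P; apply: (@squeeze_cvgr _ _ _ _ (cst 0) (fun n => 2 * C * n.+1%:R^-1)).
  - by apply: nearW => n; rewrite normr_ge0 key.
  - exact: cvg_cst.
  - rewrite -[X in _ --> X](mulr0 (2 * C)); apply: cvgM; first exact: cvg_cst.
    exact: cvg_harmonic.
have finf : (\int[mu]_(r in RP) (f r)%:E)%E \is a fin_num.
  by apply: integrable_fin_num => //; exact: integrable_halfline cf fC.
rewrite -(fineK finf) in lim1; have {}lim1 := fine_cvg lim1.
have : (fun n => F (b n) - F (a n)) @ \oo --> \int[mu]_(r in RP) f r.
  by under eq_fun do rewrite -int_f; exact: lim1.
by move/(cvg_unique _ lim2) => <-.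
Unshelve. all: by end_near. Qed.
End HalfLine.

(** * Independence of a ray integral from the angle *)

Section Rotation.
Context {R : realType}.
Notation mu := (@lebesgue_measure R).
Notation RP := (`]0, +oo[%classic : set R).

Lemma is_derive_continuous (f : R -> R) (x df : R) :
  is_derive x 1 f df -> {for x, continuous f}.
Proof. by move=> [d _]; apply: differentiable_continuous; exact/derivable1_diffP. Qed.

(* Stated on a closed interval, for which [continuity_under_integral] is applied
   to the function extended by constants outside the interval. *)
Lemma continuity_under_integral_closed (P : R -> R -> R) (a b C : R) : a <= b ->
  (forall r x, 0 < r -> a <= x <= b -> {for x, continuous (P r)}) ->
  (forall r x, 0 < r -> a <= x <= b -> {for r, continuous (P ^~ x)}) ->
  (forall r x, 0 < r -> a <= x <= b -> `|P r x| <= cauchy_bd C r) ->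
  {within `[a, b], continuous (fun x => \int[mu]_(r in `]0, +oo[) P r x)}.
Proof.
move=> ab cx cr PC.
pose cl x := Num.max a (Num.min x b).
have clP x : a <= cl x <= b.
  rewrite /cl le_max lexx/=; have [xb|bx] := leP x b.
    by rewrite ge_max ab.
  by rewrite ge_max ab lexx.
have ccl : continuous cl.
  move=> x; apply: (@continuous_max R R (cst a) ((id : R -> R) \min cst b)).
    exact: cvg_cst.
  by apply: continuous_min; [exact: cvg_id|exact: cvg_cst].
have h x : {for x, continuous (fun x => \int[mu]_(r in `]0, +oo[) P r (cl x))}.
  apply: (@continuity_under_integral R _ _ mu (fun x r => P r (cl x)) RP _
    (x - 1) (x + 1) _ _ (cauchy_bd C)) => //.
  - move=> y _; apply: (@integrable_halfline _ _ C) => r r0; first exact: cr.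
    exact: PC.
  - apply: aeW => r; rewrite /= in_itv/= andbT => r0 y _.
    apply: (@continuous_comp _ _ _ cl (P r)); first exact: ccl.
    exact: cx.
  - exact: integrable_cauchy_bd.
  - move=> y _; apply: aeW => r; rewrite /= in_itv/= andbT => r0.
    exact: PC.
  - by rewrite inE/= in_itv/= ltrBlDr ltrDl ltr01.
apply: (@subspace_eq_continuous _ _ _ (fun x => \int[mu]_(r in `]0, +oo[) P r (cl x))).
  move=> x; rewrite inE/= in_itv/= => /andP[ax xb].
  apply: eq_Rintegral => r _; congr (P r _).
  by rewrite /cl (min_idPl xb) (max_idPr ax).
by apply: continuous_subspaceT => x; exact: h.
Qed.

Lemma is_derive_under_integral (P dP : R -> R -> R) (a u v C : R) :
  u < a < v ->
  (forall r x : R, 0 < r -> u < x < v -> is_derive x 1 (P r) (dP r x)) ->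
  (forall r x : R, 0 < r -> u < x < v -> {for r, continuous (P ^~ x)}) ->
  (forall r x : R, 0 < r -> u < x < v -> `|P r x| <= cauchy_bd C r) ->
  (forall r x : R, 0 < r -> u < x < v -> `|dP r x| <= cauchy_bd C r) ->
  is_derive a 1 (fun x => \int[mu]_(r in `]0, +oo[) P r x)
    (\int[mu]_(r in `]0, +oo[) dP r a).
Proof.
move=> uav dP1 cr PC dPC.
have C0 r : 0 < r -> 0 <= cauchy_bd C r by move=> r0; exact: le_trans (PC r a r0 uav).
have C1 : 0 <= C by have := C0 1 ltr01; rewrite /cauchy_bd pmulr_lge0// invr_gt0 add1_sqr_gt0.
have C2 r : 0 <= cauchy_bd C r by rewrite divr_ge0// ltW// add1_sqr_gt0.
have Ia : `]u, v[%classic a by rewrite /= in_itv.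
have intP x : `]u, v[%classic x -> mu.-integrable RP (EFin \o P ^~ x).
  rewrite /= in_itv/= => xuv; apply: (@integrable_halfline _ _ C) => r r0; first exact: cr.
  exact: PC.
have dPE r x : 0 < r -> u < x < v -> partial1of2 (fun x r => P r x) x r = dP r x.
  move=> r0 xuv; rewrite partial1of2E /=.
  by have [_ <-] := dP1 r x r0 xuv.
have derP x r : `]u, v[%classic x -> RP r -> derivable (P r) x 1.
  rewrite /= !in_itv/= andbT => xuv r0.
  by have [] := dP1 r x r0 xuv.
have dPub x r : `]u, v[%classic x -> RP r -> `|partial1of2 (fun x r => P r x) x r| <= cauchy_bd C r.
  rewrite /= !in_itv/= andbT => xuv r0.
  by rewrite dPE// dPC.
split.
  exact: (@derivable_under_integral R _ _ mu (fun x r => P r x) RP _ a u v Ia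
    intP derP _ C2 (integrable_cauchy_bd C) dPub).
rewrite -derive1E (@differentiation_under_integral R _ _ mu (fun x r => P r x) RP _ a u v Ia
    intP derP _ C2 (integrable_cauchy_bd C) dPub)//.
apply: eq_Rintegral => r; rewrite inE/= in_itv/= andbT => r0.
exact: dPE.
Qed.

(** The Cauchy-Riemann equations enter through the shared [dP]: it is the x-derivative of [P] and
    the r-derivative of [Q]. The integral of [P] therefore has derivative 0 in x, because [Q]
    vanishes at both ends of the half-line, and the mean value theorem concludes. *)
Lemma real_rotation (P Q dP : R -> R -> R) (a b C : R) : a <= b ->
  (forall r x : R, 0 < r -> a <= x <= b -> is_derive x 1 (P r) (dP r x)) ->
  (forall r x : R, 0 < r -> a <= x <= b -> is_derive r 1 (Q ^~ x) (dP r x)) ->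
  (forall r x : R, 0 < r -> a <= x <= b -> {for r, continuous (P ^~ x)}) ->
  (forall r x : R, 0 < r -> a <= x <= b -> {for r, continuous (dP ^~ x)}) ->
  (forall r x : R, 0 < r -> a <= x <= b -> `|P r x| <= cauchy_bd C r) ->
  (forall r x : R, 0 < r -> a <= x <= b -> `|dP r x| <= cauchy_bd C r) ->
  (forall r x : R, 0 < r -> a <= x <= b -> `|Q r x| <= r * cauchy_bd C r) ->
  \int[mu]_(r in `]0, +oo[) P r b = \int[mu]_(r in `]0, +oo[) P r a.
Proof.
move=> ab Px Qr cP cdP PC dPC QC.
have cI : {within `[a, b], continuous (fun x => \int[mu]_(r in `]0, +oo[) P r x)}.
  apply: (@continuity_under_integral_closed _ _ _ C) => // r x r0 xab.
  exact: is_derive_continuous (Px _ _ r0 xab).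
have dI x : x \in `]a, b[ ->
    is_derive x 1 (fun x => \int[mu]_(r in `]0, +oo[) P r x) 0.
  rewrite in_itv/= => /andP[ax xb].
  have ax' y : a < y < b -> a <= y <= b by move=> /andP[/ltW -> /ltW ->].
  have I0 : \int[mu]_(r in `]0, +oo[) dP r x = 0.
    apply: (@integral_derive_halfline _ (Q ^~ x) (dP ^~ x) C) => r r0.
    - by apply: Qr; rewrite // !ltW.
    - by apply: cdP; rewrite // !ltW.
    - by apply: dPC; rewrite // !ltW.
    - by apply: QC; rewrite // !ltW.
  apply: is_derive_eq I0; apply: (@is_derive_under_integral P dP x a b C).
  - by rewrite ax xb.
  - by move=> r y r0 /ax' yab; exact: Px.
  - by move=> r y r0 /ax' yab; exact: cP.
  - by move=> r y r0 /ax' yab; exact: PC.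
  - by move=> r y r0 /ax' yab; exact: dPC.
have [c _] := @MVT_segment _ _ (fun=> 0) _ _ ab dI cI.
by rewrite mul0r => /eqP; rewrite subr_eq0 => /eqP.
Qed.

(** Taken componentwise as in [laplace], so that a Laplace transform is a [cint] by conversion. *)
Definition cint (f : R -> R[i]) : R[i] :=
  (\int[mu]_(r in `]0, +oo[) complex.Re (f r)) +i*
  (\int[mu]_(r in `]0, +oo[) complex.Im (f r)).

Lemma eq_cint (f g : R -> R[i]) : (forall r, 0 < r -> f r = g r) -> cint f = cint g.
Proof.
by move=> fg; apply: complex_ext; apply: eq_Rintegral => r;
   rewrite inE/= in_itv/= andbT => /fg ->.
Qed.

(* The derivative of F / r with respect to th is i X / r, which is also the
   r-derivative of i F; it integrates to a boundary term, which vanishes. *)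
Lemma rotation (F X : R -> R -> R[i]) (a b C : R) : a <= b ->
  (forall r x, 0 < r -> a <= x <= b -> phol F X r x) ->
  (forall r x, 0 < r -> a <= x <= b -> exists Y, phol X Y r x) ->
  (forall r x, 0 < r -> a <= x <= b -> cmod (F r x) <= r * cauchy_bd C r) ->
  (forall r x, 0 < r -> a <= x <= b -> cmod (X r x) <= r * cauchy_bd C r) ->
  cint (fun r => F r b / r%:C) = cint (fun r => F r a / r%:C).
Proof.
move=> ab FX XY FC XC.
have RdC (z : R[i]) (r : R) : complex.Re (z / r%:C) = complex.Re z / r.
  by rewrite -fmorphV mulrC cReRM mulrC.
have IdC (z : R[i]) (r : R) : complex.Im (z / r%:C) = complex.Im z / r.
  by rewrite -fmorphV mulrC cImRM mulrC.
have dV r : 0 < r -> {for r, continuous (fun r : R => r^-1)}.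
  by move=> r0; apply: inv_continuous; rewrite gt_eqF.
have cRe (G Y : R -> R -> R[i]) (r x : R) : 0 < r -> phol G Y r x ->
    {for r, continuous (fun r => complex.Re (G r x) / r)}.
  by move=> r0 /phol_continuous[_ [c1 _]]; apply: cvgM; [exact: c1|exact: dV].
have cIm (G Y : R -> R -> R[i]) (r x : R) : 0 < r -> phol G Y r x ->
    {for r, continuous (fun r => complex.Im (G r x) / r)}.
  by move=> r0 /phol_continuous[_ [_ c1]]; apply: cvgM; [exact: c1|exact: dV].
have bd (z : R[i]) r : 0 < r -> cmod z <= r * cauchy_bd C r ->
   [/\ `|complex.Re z| <= r * cauchy_bd C r, `|complex.Im z| <= r * cauchy_bd C r,
    `|complex.Re z / r| <= cauchy_bd C r & `|complex.Im z / r| <= cauchy_bd C r].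
  move=> r0 h; rewrite !normrM normfV !(gtr0_norm r0) !ler_pdivrMr// !(mulrC (cauchy_bd _ _)).
  by split; rewrite (le_trans _ h)// ?Re_le_cmod ?Im_le_cmod.
have divr (f : R -> R) (x df : R) r : is_derive x 1 f df -> is_derive x 1 (fun x => f x / r) (df / r).
  move=> h; apply: (is_derive_eqf (is_deriveZ r^-1 h)).
    by apply/funext => y; rewrite /GRing.scale/= mulrC.
  by rewrite /GRing.scale/= mulrC.
apply: complex_ext => /=.
- under eq_Rintegral do rewrite RdC; under [RHS]eq_Rintegral do rewrite RdC.
  (* The components of i w are - Im w and Re w, so the potential [Q] is - Im F for the real part and
     Re F for the imaginary part below. *)
  apply: (@real_rotation (fun r x => complex.Re (F r x) / r) (fun r x => - complex.Im (F r x))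
     (fun r x => - complex.Im (X r x) / r) a b C) => // r x r0 xab.
  + have [[h _] _] := FX r x r0 xab.
    apply: divr; apply: is_derive_eq h _.
    by rewrite cReM /= mul0r mul1r sub0r.
  + have [_ [_ h]] := FX r x r0 xab.
    apply: (is_derive_eqf (is_deriveN h)) => //.
    by rewrite IdC mulNr.
  + exact: cRe (FX r x r0 xab).
  + have [Y h] := XY r x r0 xab.
    have -> : (fun r => - complex.Im (X r x) / r) = (fun r => - (complex.Im (X r x) / r)).
      by apply/funext => u; rewrite mulNr.
    by apply: cvgN; exact: cIm h.
  + by have [] := bd _ r r0 (FC r x r0 xab).
  + by rewrite mulNr normrN; have [] := bd _ r r0 (XC r x r0 xab).
  + by rewrite normrN; have [] := bd _ r r0 (FC r x r0 xab).
- under eq_Rintegral do rewrite IdC; under [RHS]eq_Rintegral do rewrite IdC.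
  apply: (@real_rotation (fun r x => complex.Im (F r x) / r) (fun r x => complex.Re (F r x))
     (fun r x => complex.Re (X r x) / r) a b C) => // r x r0 xab.
  + have [[_ h] _] := FX r x r0 xab.
    apply: divr; apply: is_derive_eq h _.
    by rewrite cImM /= mul0r mul1r add0r.
  + have [_ [h _]] := FX r x r0 xab.
    by apply: is_derive_eq h _; rewrite RdC.
  + exact: cIm (FX r x r0 xab).
  + have [Y h] := XY r x r0 xab.
    exact: cRe h.
  + by have [] := bd _ r r0 (FC r x r0 xab).
  + by have [] := bd _ r r0 (XC r x r0 xab).
  + by have [] := bd _ r r0 (FC r x r0 xab).
Qed.

End Rotation.

(** * Rotation of the rays *)

Section StretchedExponential.
Context {R : realType}.
Implicit Types (nu a c r th x y t : R).

Lemma le_cos x y : 0 <= x -> x <= y -> y <= pi -> cos y <= cos x.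
Proof.
move=> x0 xy ypi; rewrite leNgt; apply/negP => h.
have := h; rewrite ltr_cos ?in_itv/= ?x0 ?ypi ?(le_trans x0) ?(le_trans xy)//.
by rewrite ltNge xy.
Qed.

Lemma powR_le1D nu r : 0 < nu <= 1 -> 0 <= r -> r `^ nu <= 1 + r.
Proof.
move=> /andP[nu0 nu1] r0; have [r1|r1] := leP r 1.
  have := ge0_ler_powR (ltW nu0) r0 ler01 r1; rewrite powR1 => h.
  by rewrite (le_trans h)// lerDl.
by rewrite (le_trans (ler1_powR (ltW r1) nu1))// lerDr.
Qed.

(** A stretched exponential decays faster than any power. The factor 1 + r leaves room for the
    logarithmic derivatives of the integrands, which grow at most linearly. *)
Lemma stretched_exp_bd nu c : 0 < nu -> 0 < c ->
  exists2 C : R, 0 < C & forall r, 0 < r ->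
    (1 + r) * expR (- (c * r `^ nu)) <= cauchy_bd C r.
Proof.
move=> nu0 c0.
(* [M] bounds r^3 exp(-c r^nu): take ln u < u at u = nu c r^nu / 3, multiply by 3 / nu and
   exponentiate. *)
pose M := expR (3 / nu * ln (3 / (nu * c))).
have M0 : 0 < M by exact: expR_gt0.
(* The product (1 + r) (1 + r^2) is at most 4 for r <= 1 and at most 4 r^3 for r > 1. *)
exists (4 + 4 * M); first by rewrite ltr_pwDl// mulr_ge0// ltW.
move=> r r0; rewrite /cauchy_bd ler_pdivlMr ?add1_sqr_gt0//.
set k := r `^ nu; have k0 : 0 < k by exact: powR_gt0.
rewrite mulrAC; have [r1|r1] := leP r 1.
  have e1 : expR (- (c * k)) <= 1 by rewrite expR_le1 oppr_le0 mulr_ge0// ltW.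
  have p4 : (1 + r) * (1 + r ^+ 2) <= 4 by nra.
  apply: (@le_trans _ _ (4 * 1)); last by rewrite mulr1 lerDl mulr_ge0// ltW.
  by rewrite ler_pM// ?expR_ge0// mulr_ge0 ?addr_ge0 ?sqr_ge0// ltW.
have p4 : (1 + r) * (1 + r ^+ 2) <= 4 * r ^+ 3.
  have r2 : 1 <= r ^+ 2 by rewrite expr_ge1// ltW.
  by rewrite exprS; nra.
apply: (@le_trans _ _ (4 * r ^+ 3 * expR (- (c * k)))).
  by rewrite ler_wpM2r ?expR_ge0.
rewrite -mulrA (@le_trans _ _ (4 * M))// ?lerDr// ler_wpM2l//.
rewrite -{1}(lnK r0) -expRM_natl -expRD ler_expR.
set w := nu * c / 3; have w0 : 0 < w by rewrite divr_gt0// mulr_gt0.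
have : ln (k * w) < k * w by rewrite ln_sublinear// mulr_gt0.
rewrite lnM ?posrE// /k ln_powR -/k.
have -> : 3 / (nu * c) = w^-1 by rewrite /w invf_div.
rewrite lnV ?posrE// => h.
have -> : 3%:R * ln r + - (c * k) = 3 / nu * (nu * ln r - k * w).
  by rewrite /w; field; rewrite gt_eqF.
by rewrite ler_wpM2l ?divr_ge0 ?(ltW nu0)//; move: h; lra.
Qed.

(** The transform to be inverted, in polar coordinates; the angle pi gives its boundary value on the
    upper side of the cut. *)
Definition estr nu a r th : R[i] := cexp (- (a%:C * zpow nu r th)).

Lemma estrE nu a r th : estr nu a r th =
  cexp (- (a * (r `^ nu * cos (nu * th))) +i* - (a * (r `^ nu * sin (nu * th)))).
Proof.
by rewrite /estr /zpow cisE; congr cexp; apply: complex_ext => /=; ring.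
Qed.

Lemma cmod_estr nu a r th :
  cmod (estr nu a r th) = expR (- (a * (r `^ nu * cos (nu * th)))).
Proof. by rewrite estrE cmod_cexp. Qed.

Lemma cmod_zpow nu r th : cmod (zpow nu r th) = r `^ nu.
Proof. by rewrite /zpow cmodM cmod_cis mulr1 cmod_real ger0_norm ?powR_ge0. Qed.

Lemma cmod_zpol r th : 0 <= r -> cmod (zpol r th) = r.
Proof. by move=> r0; rewrite /zpol cmodM cmod_cis mulr1 cmod_real ger0_norm. Qed.

Definition estrX nu a r th : R[i] := - (a%:C * (nu%:C * zpow nu r th)) * estr nu a r th.

Lemma phol_estr nu a r th : 0 < r -> phol (estr nu a) (estrX nu a) r th.
Proof.
move=> r0; have h := pholM (phol_cst (- a%:C) r th) (phol_zpow nu th r0).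
have -> : estr nu a = (fun r th => cexp (- a%:C * zpow nu r th)).
  by apply/funext => u; apply/funext => v; rewrite /estr mulNr.
apply: phol_eqX (phol_exp h) _.
by rewrite /estrX /estr mul0r add0r !mulNr.
Qed.

End StretchedExponential.

(** * Turning the rays for e^(tz) F(z) and for F(z) / (s - z) *)

Section RotateRays.
Context {R : realType}.
Implicit Types (nu a c r th x y t m : R).
Notation mu := (@lebesgue_measure R).

(** Follows the shape of the function and instantiates its derivative on the way; the non-vanishing
    of denominators is left as a goal. *)
Ltac phol_auto r0 := repeat lazymatch goal with
  | |- phol (zpow _) _ _ _ => exact: phol_zpow
  | |- phol zpol _ _ _ => apply: phol_zpol; rewrite gt_eqF//; exact: r0
  | |- phol (estr _ _) _ _ _ => exact: (phol_estr _ _ _ r0)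
  | |- phol (fun r th => _ - zpol r th) _ _ _ => apply: phol_zpolB; rewrite gt_eqF//; exact: r0
  | |- phol (fun r th => _ + _) _ _ _ => apply: pholD
  | |- phol (fun r th => _ * _) _ _ _ => apply: pholM
  | |- phol (fun r th => (_)^-1) _ _ _ => apply: pholV
  | |- phol (fun r th => cexp _) _ _ _ => apply: phol_exp
  | |- phol (fun r th => _) _ _ _ => exact: phol_cst
  end.

Lemma estrXE nu a : estrX nu a = fun r th =>
  (- (a * nu)%:C * zpow nu r th) * estr nu a r th.
Proof.
by apply/funext => r; apply/funext => th; rewrite /estrX rmorphM/= !mulNr !mulrA.
Qed.

(** For nu <= 1/2 the power z^nu maps the right half-plane into the sector of half-angle pi/4, where
    Re z^nu >= cos(pi/4) |z|^nu. *)
Lemma cmod_estr_le nu a r th : 0 < nu -> nu <= 1 / 2 -> 0 < a -> 0 < r ->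
  - (pi / 2) <= th <= pi / 2 ->
  cmod (estr nu a r th) <= expR (- (a * cos (pi / 4) * r `^ nu)).
Proof.
move=> nu0 nu1 a0 r0 /andP[th1 th2]; rewrite cmod_estr ler_expR lerN2.
rewrite -mulrA ler_pM2l// [leLHS]mulrC ler_pM2l ?powR_gt0//.
rewrite -[leRHS]cos_norm; have pi0 := @pi_gt0 R.
have hth : `|th| <= pi / 2 by rewrite ler_norml th1.
rewrite normrM (ger0_norm (ltW nu0)).
apply: le_cos; rewrite ?mulr_ge0 ?normr_ge0 ?(ltW nu0)//; last by lra.
have := normr_ge0 th; nra.
Qed.

(* At th = pi / 2 only F decays, and at th = pi (when nu = 1 / 2) only e^(tz). *)
Lemma ray_exponent_bd nu a t : 0 < nu -> nu <= 1 / 2 -> 0 < a -> 0 < t ->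
  exists2 c, 0 < c & forall r th, 0 < r -> pi / 2 <= th <= pi ->
    t * (r * cos th) - a * (r `^ nu * cos (nu * th)) <= c - c * r `^ nu.
Proof.
move=> nu0 nu1 a0 t0; have pi0 := @pi_gt0 R.
(* The angles are split at 3 pi / 4. Below it nu th <= 3 pi / 8, and F decays at rate [c1]. Above it
   cos th <= cos(3 pi / 4), and e^(tz) decays at rate [c2] in r; the inequality r^nu <= 1 + r turns
   this into decay in r^nu, at the price of the additive constant. *)
pose c1 := a * cos (3 / 8 * pi); pose c2 := - (t * cos (3 / 4 * pi)).
have c10 : 0 < c1 by rewrite mulr_gt0// cos_gt0_pihalf//; lra.
have c20 : 0 < c2.
  rewrite /c2 -mulrN mulr_gt0//.
  rewrite (_ : 3 / 4 * pi = pi / 4 + pi / 2); last by lra.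
  by rewrite cosDpihalf opprK sin_gt0_pihalf//; lra.
exists (Num.min c1 c2); first by rewrite lt_min c10.
set c := Num.min c1 c2.
have c0 : 0 < c by rewrite lt_min c10.
move=> r th r0 /andP[th1 th2].
have k0 : 0 < r `^ nu by exact: powR_gt0.
have k1 : r `^ nu <= 1 + r by apply: powR_le1D; rewrite ?(ltW r0)//; lra.
set k := r `^ nu in k0 k1 *.
have cc1 : c <= c1 by rewrite ge_min lexx.
have cc2 : c <= c2 by rewrite ge_min lexx orbT.
have [th3|th3] := leP th (3 / 4 * pi).
  have h1 : cos th <= 0 by rewrite -cos_pihalf; apply: le_cos => //; lra.
  have h2 : cos (3 / 8 * pi) <= cos (nu * th) by apply: le_cos; nra.
  have h3 : t * (r * cos th) <= 0 by rewrite mulr_ge0_le0 ?(ltW t0)// mulr_ge0_le0// ltW.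
  have h4 : c1 * k <= a * (k * cos (nu * th)).
    by rewrite /c1 mulrAC -[leLHS]mulrA ler_pM2l// ler_pM2l.
  have h5 : c * k <= c1 * k by rewrite ler_pM2r.
  by move: h3 h4 h5 c0; lra.
have h1 : cos th <= cos (3 / 4 * pi) by apply: le_cos => //; lra.
have h2 : 0 <= cos (nu * th) by apply: cos_ge0_pihalf; apply/andP; split; nra.
have h3 : t * (r * cos th) <= - c2 * r.
  by rewrite /c2 opprK mulrAC -[leRHS]mulrA ler_pM2l// ler_pM2l.
have h4 : 0 <= a * (k * cos (nu * th)) by rewrite mulr_ge0 ?(ltW a0)// mulr_ge0// ltW.
have h5 : c * r <= c2 * r by rewrite ler_pM2r.
have h6 : c * k <= c * (1 + r) by rewrite ler_pM2l.
by move: h3 h4 h5 h6; lra.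
Qed.

Lemma ray_rotation nu a t : 0 < nu -> nu <= 1 / 2 -> 0 < a -> 0 < t ->
  cint (fun r => cis pi * (cexp (t%:C * zpol r pi) * estr nu a r pi)) =
  cint (fun r => cis (pi / 2) * (cexp (t%:C * zpol r (pi / 2)) * estr nu a r (pi / 2))).
Proof.
move=> nu0 nu1 a0 t0; have pi0 := @pi_gt0 R.
pose G r th := cexp (t%:C * zpol r th) * estr nu a r th.
pose F r th := zpol r th * G r th.
(* [F] is z e^(tz) exp(-a z^nu), the factor z because [rotation] divides by r, which leaves dz/dr =
   e^(i th). [L] is z times the logarithmic derivative of this [F]. *)
pose L r th := 1 + t%:C * zpol r th + (- (a * nu)%:C * zpow nu r th).
have [c c0 hc] := ray_exponent_bd nu0 nu1 a0 t0.
have [C C0 hC] := stretched_exp_bd nu0 c0.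
(* The modulus of [L] is at most (1 + t + a) (1 + r), and that of [G] at most e^c exp(-c r^nu); [C]
   absorbs the product of 1 + r with the stretched exponential. *)
pose K := (1 + t + a) * expR c * C.
have FE r th : 0 < r -> F r th / r%:C = cis th * G r th.
  move=> r0; rewrite /F /zpol; have : r%:C != 0 by apply/eqP => -[/eqP]; rewrite gt_eqF.
  by move: (cis th) (G r th) => u v ?; field.
have cintE th : cint (fun r => F r th / r%:C) = cint (fun r => cis th * G r th).
  by apply: eq_cint => r /FE.
rewrite -!cintE.
have Gbd r th : 0 < r -> pi / 2 <= th <= pi ->
    cmod (G r th) <= expR c * expR (- (c * r `^ nu)).
  move=> r0 hth; rewrite cmodM cmod_cexp cmod_estr cReRM cReRM cisE -!expRD ler_expR.
  exact: hc.
have Ebd r : 0 < r -> expR c * ((1 + r) * expR (- (c * r `^ nu))) <= expR c * cauchy_bd C r.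
  by move=> r0; rewrite ler_pM2l ?expR_gt0// hC.
have Kbd r : 0 < r -> (1 + t + a) * (expR c * cauchy_bd C r) = cauchy_bd K r.
  by move=> r0; rewrite /cauchy_bd /K !mulrA.
apply: (@rotation _ F (fun r th => F r th * L r th) (pi / 2) pi K).
- by lra.
- move=> r th r0 _; apply: phol_eqX; first by rewrite /F /G; phol_auto r0.
  cbv beta; rewrite estrXE /F /G /L.
  by move: (estr _ _ _ _) => u; move: (zpow _ _ _) => v; move: (cexp _) => w; move: (zpol _ _) => z; ring.
- by move=> r th r0 _; eexists; rewrite /F /G /L; phol_auto r0.
- move=> r th r0 hth; rewrite cmodM cmod_zpol ?(ltW r0)// ler_pM2l//.
  rewrite (le_trans (Gbd _ _ r0 hth))// -Kbd//.
  have h1 : expR c * expR (- (c * r `^ nu)) <= expR c * ((1 + r) * expR (- (c * r `^ nu))).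
    by rewrite ler_pM2l ?expR_gt0// ler_peMl ?expR_ge0// lerDl ltW.
  rewrite (le_trans h1)// (le_trans (Ebd _ r0))// ler_peMl//.
    by rewrite mulr_ge0 ?expR_ge0// divr_ge0 ?(ltW C0)// ltW// add1_sqr_gt0.
  by lra.
- move=> r th r0 hth; rewrite cmodM cmodM cmod_zpol ?(ltW r0)// -mulrA ler_pM2l//.
  have Lbd : cmod (L r th) <= (1 + t + a) * (1 + r).
    rewrite /L (le_trans (cmodD _ _))//.
    apply: (@le_trans _ _ ((1 + t * r) + a * (1 + r))); last by nra.
    apply: lerD.
      rewrite (le_trans (cmodD _ _))// cmodM cmod_zpol ?(ltW r0)//.
      by rewrite -(_ : 1%:C = 1)// !cmod_real normr1 gtr0_norm.
    rewrite cmodM cmodN cmod_real cmod_zpow gtr0_norm ?mulr_gt0//.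
    have k1 : r `^ nu <= 1 + r by apply: powR_le1D; rewrite ?(ltW r0)//; lra.
    rewrite ler_pM ?powR_ge0 ?mulr_ge0 ?(ltW a0) ?(ltW nu0)//.
    by rewrite ler_piMr ?(ltW a0)//; lra.
  rewrite -Kbd//; apply: le_trans (ler_pM (cmod_ge0 _) (cmod_ge0 _) (Gbd _ _ r0 hth) Lbd) _.
  rewrite mulrC -[leLHS]mulrA ler_wpM2l//; first by lra.
  by rewrite mulrCA Ebd.
Qed.

(** The law of cosines. *)
Lemma cmod_zpolB m al r th :
  cmod (zpol m al - zpol r th) ^+ 2 = m ^+ 2 - 2 * m * r * cos (th - al) + r ^+ 2.
Proof.
transitivity (m ^+ 2 * (cos al ^+ 2 + sin al ^+ 2) -
  2 * m * r * (cos th * cos al + sin th * sin al) + r ^+ 2 * (cos th ^+ 2 + sin th ^+ 2)).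
  by rewrite sqr_cmod /zpol !cisE /=; ring.
by rewrite !cos2Dsin2 !mulr1 cosB.
Qed.

(** m sin p is the distance from the point of modulus m to the line making the angle p with its ray;
    completing the square leaves (r - m cos p)^2. *)
Lemma cmod_zpolB_ge m al r th p : 0 < m -> 0 < r -> 0 < p < pi ->
  cos (th - al) <= cos p -> m * sin p <= cmod (zpol m al - zpol r th).
Proof.
move=> m0 r0 /andP[p0 p1] h.
have s0 : 0 <= sin p by apply: sin_ge0_pi; rewrite !ltW.
rewrite -(@ler_pXn2r _ 2)// ?nnegrE ?mulr_ge0 ?cmod_ge0 ?(ltW m0)//.
rewrite cmod_zpolB exprMn sin2cos2.
have h2 : m * r * cos (th - al) <= m * r * cos p by rewrite ler_pM2l// mulr_gt0.
have := sqr_ge0 (r - m * cos p); rewrite sqrrB; nra.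
Qed.

(** The contribution of one ray to the Cauchy integral of F(z) dz / (s - z), with dz = e^(i th)
    dr. *)
Definition hray nu a (s : R[i]) th : R[i] :=
  cint (fun r => cis th * (estr nu a r th / (s - zpol r th))).

(** As long as the turning ray keeps an angle of at least p from the ray through s, it stays at
    distance at least m sin p from the pole, and the kernel is bounded. *)
Lemma hray_rotation nu a m al p x y : 0 < nu -> nu <= 1 / 2 -> 0 < a ->
  0 < m -> 0 < p < pi -> - (pi / 2) <= x -> x <= y -> y <= pi / 2 ->
  (forall th, x <= th <= y -> cos (th - al) <= cos p) ->
  hray nu a (zpol m al) y = hray nu a (zpol m al) x.
Proof.
move=> nu0 nu1 a0 m0 /andP[p0 p1] x1 xy y1 hp; have pi0 := @pi_gt0 R.
set s := zpol m al.
pose G r th := estr nu a r th / (s - zpol r th).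
pose F r th := zpol r th * G r th.
(* Again z times the logarithmic derivative of [F], which here is z exp(-a z^nu) / (s - z). *)
pose L r th := 1 + (- (a * nu)%:C * zpow nu r th) + zpol r th / (s - zpol r th).
pose c := a * cos (pi / 4).
have c0 : 0 < c by rewrite mulr_gt0// cos_gt0_pihalf//; lra.
have [C C0 hC] := stretched_exp_bd nu0 c0.
pose d := m * sin p.
have d0 : 0 < d by rewrite mulr_gt0// sin_gt0_pi// p0.
have dle r th : 0 < r -> x <= th <= y -> d <= cmod (s - zpol r th).
  by move=> r0 hth; apply: cmod_zpolB_ge => //; [rewrite p0|exact: hp].
have sz0 r th : 0 < r -> x <= th <= y -> s - zpol r th != 0.
  by move=> r0 hth; rewrite -cmod_eq0 gt_eqF// (lt_le_trans d0)// dle.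
have dV r th : 0 < r -> x <= th <= y -> cmod (s - zpol r th)^-1 <= d^-1.
  by move=> r0 hth; rewrite cmodV lef_pV2 ?posrE ?(lt_le_trans d0)// dle.
pose K := d^-1 * (1 + a + d^-1) * C.
have FE r th : 0 < r -> F r th / r%:C = cis th * G r th.
  move=> r0; rewrite /F /zpol; have : r%:C != 0 by apply/eqP => -[/eqP]; rewrite gt_eqF.
  by move: (cis th) (G r th) => u v ?; field.
have cintE th : cint (fun r => F r th / r%:C) = hray nu a s th.
  by apply: eq_cint => r /FE.
rewrite -!cintE.
have Gbd r th : 0 < r -> x <= th <= y ->
    cmod (G r th) <= d^-1 * expR (- (c * r `^ nu)).
  move=> r0 hth; rewrite cmodM mulrC; apply: ler_pM; rewrite ?cmod_ge0//.
    exact: dV.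
  by apply: cmod_estr_le => //; case/andP: hth => h1 h2; rewrite (le_trans x1)// (le_trans h2).
have Kbd r : 0 < r -> (1 + a + d^-1) * (d^-1 * cauchy_bd C r) = cauchy_bd K r.
  by move=> r0; rewrite /cauchy_bd /K; ring.
have dV0 : 0 < d^-1 by rewrite invr_gt0.
apply: (@rotation _ F (fun r th => F r th * L r th) x y K).
- exact: xy.
- move=> r th r0 hth; apply: phol_eqX; first by rewrite /F /G; phol_auto r0; exact: sz0.
  have := sz0 r th r0 hth.
  cbv beta; rewrite estrXE /F /G /L.
  by move: (estr _ _ _ _) => u; move: (s - _) => v; move: (zpol _ _) => w; move: (zpow _ _ _) => z ?; field.
- by move=> r th r0 hth; eexists; rewrite /F /G /L; phol_auto r0; exact: sz0.
- move=> r th r0 hth; rewrite cmodM cmod_zpol ?(ltW r0)// ler_pM2l//.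
  rewrite (le_trans (Gbd _ _ r0 hth))// -Kbd//.
  have h1 : d^-1 * expR (- (c * r `^ nu)) <= d^-1 * ((1 + r) * expR (- (c * r `^ nu))).
    by rewrite ler_pM2l// ler_peMl ?expR_ge0// lerDl ltW.
  apply: (le_trans h1); rewrite -[leLHS]mul1r; apply: ler_pM => //; try lra.
    by rewrite mulr_ge0 ?(ltW dV0)// mulr_ge0 ?expR_ge0//; lra.
  by rewrite ler_pM2l// hC.
- move=> r th r0 hth; rewrite cmodM cmodM cmod_zpol ?(ltW r0)// -mulrA ler_pM2l//.
  have Lbd : cmod (L r th) <= (1 + a + d^-1) * (1 + r).
    rewrite /L (le_trans (cmodD _ _))//.
    apply: (@le_trans _ _ ((1 + a * (1 + r)) + r * d^-1)); last by nra.
    apply: lerD.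
      rewrite (le_trans (cmodD _ _))// -(_ : 1%:C = 1)// cmod_real normr1 lerD2l.
      rewrite cmodM cmodN cmod_real cmod_zpow gtr0_norm ?mulr_gt0//.
      have k1 : r `^ nu <= 1 + r by apply: powR_le1D; rewrite ?(ltW r0)//; lra.
      rewrite ler_pM ?powR_ge0 ?mulr_ge0 ?(ltW a0) ?(ltW nu0)//.
      by rewrite ler_piMr ?(ltW a0)//; lra.
    by rewrite cmodM cmod_zpol ?(ltW r0)// ler_pM2l// dV.
  rewrite -Kbd//; apply: le_trans (ler_pM (cmod_ge0 _) (cmod_ge0 _) (Gbd _ _ r0 hth) Lbd) _.
  rewrite mulrC -[leLHS]mulrA ler_wpM2l//; first by lra.
  by rewrite mulrCA ler_pM2l// (le_trans _ (hC _ r0)).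
Qed.

End RotateRays.

(** * The residue at s *)

Section Residue.
Context {R : realType}.
Implicit Types (nu a c r th x y t m p : R).
Notation mu := (@lebesgue_measure R).
Notation RP := (`]0, +oo[%classic : set R).

(* The Cauchy kernel dz / (s - z) along the ray at angle p from the ray through s,
   where |s| = m. *)
Definition kap m r p : R[i] := cis p / (zpol m 0 - zpol r p).

(** In r this is the Lorentzian h / ((r - m cos p)^2 + h^2) with h = m sin p, which concentrates at
    r = m as p tends to 0. *)
Definition poisson m r p : R := m * sin p / (m ^+ 2 - 2 * m * r * cos p + r ^+ 2).

Lemma cis_neq0 p : cis p != 0 :> R[i].
Proof. by rewrite -cexp_imag cexp_neq0. Qed.

(** The kernel dz / (s - z) is invariant under a common rotation of s and z, so s may be taken on
    the positive axis. *)
Lemma kapE m al r p :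
  cis (al + p) / (zpol m al - zpol r (al + p)) = kap m r p.
Proof.
have -> : zpol m al - zpol r (al + p) = cis al * (zpol m 0 - zpol r p).
  have zE u v : zpol u (al + v) = cis al * zpol u v by rewrite /zpol mulrCA cisD.
  by rewrite mulrBr -!zE addr0.
rewrite cisD /kap; have := cis_neq0 al.
move: (cis al) (zpol m 0 - _) => u v u0; rewrite invfM.
by rewrite mulrACA divff// mul1r.
Qed.

Lemma kap_formula m r p : m ^+ 2 - 2 * m * r * cos p + r ^+ 2 != 0 ->
  kap m r p = ((m * cos p - r) / (m ^+ 2 - 2 * m * r * cos p + r ^+ 2)) +i*
              poisson m r p.
Proof.
move=> D0; rewrite /kap /poisson.
have w2 : complex.Re (zpol m 0 - zpol r p) ^+ 2 + complex.Im (zpol m 0 - zpol r p) ^+ 2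
    = m ^+ 2 - 2 * m * r * cos p + r ^+ 2.
  by rewrite -sqr_cmod cmod_zpolB subr0.
have wR : complex.Re (zpol m 0 - zpol r p) = m - r * cos p.
  by rewrite /zpol !cisE cos0 sin0 /=; ring.
have wI : complex.Im (zpol m 0 - zpol r p) = - (r * sin p).
  by rewrite /zpol !cisE cos0 sin0 /=; ring.
have cs := cos2Dsin2 p.
apply: complex_ext; rewrite ?cReM ?cImM cReV cImV w2 wR wI cisE /=.
  transitivity ((m * cos p - r * (cos p ^+ 2 + sin p ^+ 2)) /
    (m ^+ 2 - 2 * m * r * cos p + r ^+ 2)); first by field.
  by rewrite cs mulr1.
by field.
Qed.

Lemma poisson_den m r p :
  m ^+ 2 - 2 * m * r * cos p + r ^+ 2 = (r - m * cos p) ^+ 2 + (m * sin p) ^+ 2.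
Proof. by rewrite exprMn sin2cos2; ring. Qed.

Lemma poisson_den_gt0 m r p : 0 < m -> 0 < p < pi ->
  0 < m ^+ 2 - 2 * m * r * cos p + r ^+ 2.
Proof.
move=> m0 hp; rewrite poisson_den ltr_wpDl ?sqr_ge0// exprn_gt0// mulr_gt0//.
exact: sin_gt0_pi.
Qed.

(** The kernels at p and -p are conjugate. Their difference loses the real part, which is of order
    1/r at infinity and not integrable. *)
Lemma kapB m r p : 0 < m -> 0 < p < pi ->
  kap m r p - kap m r (- p) = 0 +i* (2 * poisson m r p).
Proof.
move=> m0 hp; have D0 := lt0r_neq0 (poisson_den_gt0 r m0 hp).
rewrite !kap_formula ?cosN// /poisson cosN sinN; apply: complex_ext => /=; field; exact: D0.
Qed.

Lemma atan_cot p : 0 < p < pi -> atan (cos p / sin p) = pi / 2 - p.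
Proof.
move=> /andP[p0 p1]; have -> : cos p / sin p = tan (pi / 2 - p).
  rewrite /tan sinB cosB sin_pihalf cos_pihalf !mul1r !mul0r subr0 add0r.
  by [].
by rewrite tanK// in_itv/=; apply/andP; split; lra.
Qed.

(** The Lorentzian has an arctangent as primitive, running from -(pi/2 - p) at r = 0 to pi/2 at
    infinity; the mass p missing from pi lies on r < 0. *)
Lemma integral_poisson m p : 0 < m -> 0 < p < pi ->
  mu.-integrable RP (EFin \o (fun r => poisson m r p)) /\
  \int[mu]_(r in `]0, +oo[) poisson m r p = pi - p.
Proof.
move=> m0 hp; have sp0 : 0 < sin p by exact: sin_gt0_pi.
have ms0 : 0 < m * sin p by rewrite mulr_gt0.
pose F r : R := atan ((r - m * cos p) / (m * sin p)).
have dF (r : R) : is_derive r 1 F (poisson m r p).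
  have d1 : is_derive r (1 : R) (fun r : R => (r - m * cos p) / (m * sin p)) (m * sin p)^-1.
    apply: (is_derive_eqf (is_deriveZ (m * sin p)^-1
       (is_deriveB (is_derive_id r 1) (is_derive_cst (m * cos p) r 1)))).
      by apply/funext => u; rewrite /GRing.scale/= [LHS]mulrC.
    by rewrite /GRing.scale/= subr0 mulr1.
  apply: is_derive_eq (is_derive1_comp (is_derive1_atan _) d1) _.
  have := poisson_den_gt0 r m0 hp; rewrite /poisson poisson_den => /lt0r_neq0 D0.
  rewrite /GRing.scale/=; field; rewrite D0 !gt_eqF//=.
have cP r : {for r, continuous (fun r => poisson m r p)}.
  apply: cvgM; first exact: cvg_cst.
  apply: cvgV; first by rewrite gt_eqF// poisson_den_gt0.
  apply: cvgD; last by apply: cvgM; exact: cvg_id.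
  apply: cvgB; first exact: cvg_cst.
  apply: cvgM; last exact: cvg_cst.
  by apply: cvgM; [exact: cvg_cst|exact: cvg_id].
have P0 r : 0 <= poisson m r p.
  by rewrite divr_ge0 ?(ltW ms0)// ltW// poisson_den_gt0.
have FTC : (\int[mu]_(r in `]0%R, +oo[) (poisson m r p)%:E = (pi - p)%:E)%E.
  rewrite integral_itv_obnd_cbnd; last first.
    by apply/measurable_EFinP; apply: measurable_halfline.
  rewrite (@ge0_continuous_FTC2y _ (fun r => poisson m r p) F 0 (pi / 2))//.
  - rewrite -EFinB; congr (_%:E); rewrite /F sub0r mulNr atanN.
    rewrite invfM mulrACA divff ?gt_eqF// mul1r atan_cot//; lra.
  - by apply: continuous_subspaceT => r; exact: cP.
  - apply: (@cvg_comp _ _ _ (fun r => (r - m * cos p) / (m * sin p)) atan _ (pinfty_nbhs R)); last exact: cvgy_atan.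
    apply/cvgryPge => A; near=> r; rewrite ler_pdivlMr// lerBrDr.
    by near: r; apply: nbhs_pinfty_ge; exact: num_real.
  - by apply: cvg_at_right_filter; exact: is_derive_continuous (dF 0).
  - by move=> r _; rewrite derive1E; have [_ ->] := dF r.
split; last by rewrite /Rintegral FTC.
apply/integrableP; split; first by apply/measurable_EFinP; apply: measurable_halfline.
under eq_integral do rewrite /= ger0_norm//.
by rewrite FTC ltry.
Unshelve. all: by end_near. Qed.

(** The mean value theorem is applied to the two components, in general at different points; hence
    the factor 2. *)
Lemma cderive_lipschitz (f df : R -> R[i]) x y K :
  (forall z, Num.min x y <= z <= Num.max x y -> cderive f z (df z)) ->
  (forall z, Num.min x y <= z <= Num.max x y -> cmod (df z) <= K) ->
  cmod (f y - f x) <= 2 * K * `|y - x|.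
Proof.
wlog xy : x y / x <= y => [hw d1 d2|].
  have [xy|yx] := leP x y; first exact: hw.
  have -> : f y - f x = - (f x - f y) by rewrite opprB.
  by rewrite cmodN distrC; apply: hw; rewrite ?(ltW yx)// minC maxC.
rewrite (min_idPl xy) (max_idPr xy) => d1 d2.
have [c1 c1xy e1] : exists2 c, c \in `[x, y] &
    complex.Re (f y) - complex.Re (f x) = complex.Re (df c) * (y - x).
  apply: (@MVT_segment _ (fun u => complex.Re (f u)) (fun u => complex.Re (df u))) => //.
    by move=> z; rewrite in_itv/= => /andP[z1 z2]; have [|] := d1 z; rewrite ?(ltW z1) ?(ltW z2).
  by apply: continuous_within_itv => z /d1 [h _]; exact: is_derive_continuous h.
have [c2 c2xy e2] : exists2 c, c \in `[x, y] &
    complex.Im (f y) - complex.Im (f x) = complex.Im (df c) * (y - x).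
  apply: (@MVT_segment _ (fun u => complex.Im (f u)) (fun u => complex.Im (df u))) => //.
    by move=> z; rewrite in_itv/= => /andP[z1 z2]; have [|] := d1 z; rewrite ?(ltW z1) ?(ltW z2).
  by apply: continuous_within_itv => z /d1 [_ h]; exact: is_derive_continuous h.
rewrite (le_trans (cmod_le _))// cReD cImD cReN cImN e1 e2 !normrM -mulrDl.
rewrite ler_wpM2r// (_ : 2 * K = K + K); last by ring.
apply: lerD.
  by rewrite (le_trans (Re_le_cmod _))// d2//; move: c1xy; rewrite in_itv.
by rewrite (le_trans (Im_le_cmod _))// d2//; move: c2xy; rewrite in_itv.
Qed.

End Residue.

(** * Linearity and limits of complex integrals over the half-line *)

Section ComplexIntegral.
Context {R : realType}.
Notation mu := (@lebesgue_measure R).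
Notation RP := (`]0, +oo[%classic : set R).

Definition cintegrable (f : R -> R[i]) : Prop :=
  mu.-integrable RP (EFin \o (fun r => complex.Re (f r))) /\
  mu.-integrable RP (EFin \o (fun r => complex.Im (f r))).

Lemma integrable_lin (f g : R -> R) (x y : R) :
  mu.-integrable RP (EFin \o f) -> mu.-integrable RP (EFin \o g) ->
  mu.-integrable RP (EFin \o (fun r => x * f r + y * g r)) /\
  \int[mu]_(r in RP) (x * f r + y * g r) =
    x * \int[mu]_(r in RP) f r + y * \int[mu]_(r in RP) g r.
Proof.
move=> hf hg.
have hx (h : R -> R) z : mu.-integrable RP (EFin \o h) ->
    mu.-integrable RP (EFin \o (fun r => z * h r)).
  move=> hh; rewrite (_ : EFin \o _ = (fun r : R => z%:E * (h r)%:E)%E).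
    exact: integrableZl.
  by apply/funext => r /=; rewrite EFinM.
split.
  rewrite (_ : EFin \o _ = ((EFin \o (fun r => (x * f r)%R)) \+ (EFin \o (fun r => (y * g r)%R)))%E).
    by apply: integrableD => //; exact: hx.
  by apply/funext => r /=; rewrite EFinD.
by rewrite RintegralD ?RintegralZl//; exact: hx.
Qed.

Lemma cintD (f g : R -> R[i]) : cintegrable f -> cintegrable g ->
  cintegrable (fun r => f r + g r) /\ cint (fun r => f r + g r) = cint f + cint g.
Proof.
move=> [f1 f2] [g1 g2].
have [i1 e1] := integrable_lin 1 1 f1 g1.
have [i2 e2] := integrable_lin 1 1 f2 g2.
have E1 : (fun r => complex.Re (f r + g r)) = (fun r => 1 * complex.Re (f r) + 1 * complex.Re (g r)).
  by apply/funext => r; rewrite cReD !mul1r.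
have E2 : (fun r => complex.Im (f r + g r)) = (fun r => 1 * complex.Im (f r) + 1 * complex.Im (g r)).
  by apply/funext => r; rewrite cImD !mul1r.
split; first by rewrite /cintegrable E1 E2.
by apply: complex_ext; rewrite /cint ?cReD ?cImD /= ?E1 ?E2 ?e1 ?e2 !mul1r.
Qed.

Lemma cintZ (c : R[i]) (f : R -> R[i]) : cintegrable f ->
  cintegrable (fun r => c * f r) /\ cint (fun r => c * f r) = c * cint f.
Proof.
move=> [f1 f2].
have [i1 e1] := integrable_lin (complex.Re c) (- complex.Im c) f1 f2.
have [i2 e2] := integrable_lin (complex.Re c) (complex.Im c) f2 f1.
have E1 : (fun r => complex.Re (c * f r)) =
    (fun r => complex.Re c * complex.Re (f r) + - complex.Im c * complex.Im (f r)).
  by apply/funext => r; rewrite cReM mulNr.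
have E2 : (fun r => complex.Im (c * f r)) =
    (fun r => complex.Re c * complex.Im (f r) + complex.Im c * complex.Re (f r)).
  by apply/funext => r; rewrite cImM.
split; first by rewrite /cintegrable E1 E2.
by apply: complex_ext; rewrite /cint ?cReM ?cImM /= ?E1 ?E2 ?e1 ?e2 ?mulNr.
Qed.

Lemma cintB (f g : R -> R[i]) : cintegrable f -> cintegrable g ->
  cintegrable (fun r => f r - g r) /\ cint (fun r => f r - g r) = cint f - cint g.
Proof.
move=> hf hg; have [ig eg] := cintZ (-1) hg.
have := cintD hf ig; rewrite eg mulN1r.
by have -> : (fun r => f r + -1 * g r) = (fun r => f r - g r)
  by apply/funext => r; rewrite mulN1r.
Qed.

Lemma cintegrable_bd (f : R -> R[i]) (C : R) :
  (forall r, 0 < r -> ccontinuous_at f r) ->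
  (forall r, 0 < r -> cmod (f r) <= cauchy_bd C r) -> cintegrable f.
Proof.
move=> cf fC; split; apply: (@integrable_halfline _ _ C) => r r0.
- by have [] := cf r r0.
- by rewrite (le_trans (Re_le_cmod _))// fC.
- by have [] := cf r r0.
- by rewrite (le_trans (Im_le_cmod _))// fC.
Qed.

(* The exceptional point m is the pole of the Cauchy kernel. *)
Lemma dominated_cvg0 (f_ : nat -> R -> R) (C m : R) :
  (forall n, measurable_fun RP (f_ n)) ->
  (forall n r, 0 < r -> `|f_ n r| <= cauchy_bd C r) ->
  (forall r, 0 < r -> r != m -> f_ n r @[n --> \oo] --> 0) ->
  \int[mu]_(r in RP) f_ n r @[n --> \oo] --> 0.
Proof.
move=> mf fC f0.
have [] := @dominated_convergence _ _ _ mu RP _ (fun n r => (f_ n r)%:E) (cst 0%E)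
   (EFin \o cauchy_bd C) _ _ _ (integrable_cauchy_bd C) _.
- by [].
- by move=> n; apply/measurable_EFinP; exact: mf.
- exact: measurable_cst.
- exists [set m]; split.
  + exact: measurable_set1.
  + exact: lebesgue_measure_set1.
  + move=> r /=; apply: contraPP => /eqP rm; apply; rewrite in_itv/= andbT => r0.
    by apply: cvg_EFin; [exact: nearW|exact: f0].
- by apply: aeW => r n; rewrite /= in_itv/= andbT => r0; rewrite lee_fin fC.
move=> _ _; rewrite integral0_eq// => h.
exact: fine_cvg h.
Qed.

End ComplexIntegral.

(** * Lipschitz bound for F at s *)

Section KernelBounds.
Context {R : realType}.
Implicit Types (nu a c r th x y t m p : R).
Notation mu := (@lebesgue_measure R).
Notation RP := (`]0, +oo[%classic : set R).

Lemma sin_ge_linear p q : 0 <= p -> p <= q -> q < pi / 2 -> p * cos q <= sin p.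
Proof.
move=> p0 pq q1; have pi0 := @pi_gt0 R.
have [c] := @MVT_segment _ sin cos 0 p p0 (fun x _ => is_derive_sin x)
  (continuous_subspaceT (@continuous_sin R)).
rewrite in_itv/= => /andP[c0 cp]; rewrite sin0 !subr0 mulrC => ->.
by rewrite ler_wpM2l//; apply: le_cos => //; lra.
Qed.

Lemma cmod_estr_le1 nu a r th : 0 < nu -> nu <= 1 / 2 -> 0 < a -> 0 < r ->
  - (pi / 2) <= th <= pi / 2 -> cmod (estr nu a r th) <= 1.
Proof.
move=> nu0 nu1 a0 r0 hth; rewrite (le_trans (cmod_estr_le _ _ _ _ hth))//.
rewrite expR_le1 oppr_le0 mulr_ge0 ?powR_ge0// mulr_ge0 ?(ltW a0)//.
by have pi0 := @pi_gt0 R; apply: cos_ge0_pihalf; apply/andP; split; lra.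
Qed.

Lemma cmod_estrX nu a r th : 0 < nu -> nu <= 1 / 2 -> 0 < a -> 0 < r ->
  - (pi / 2) <= th <= pi / 2 -> cmod (estrX nu a r th) <= a * (1 + r).
Proof.
move=> nu0 nu1 a0 r0 hth; rewrite estrXE 2!cmodM cmodN cmod_real cmod_zpow.
rewrite gtr0_norm ?mulr_gt0// -[leRHS]mulr1; apply: ler_pM; rewrite ?cmod_ge0//.
- by rewrite mulr_ge0 ?powR_ge0// mulr_ge0 ?ltW.
- have k1 : r `^ nu <= 1 + r by apply: powR_le1D; rewrite ?(ltW r0)//; lra.
  rewrite ler_pM ?powR_ge0 ?mulr_ge0 ?(ltW a0) ?(ltW nu0)//.
  by rewrite ler_piMr ?(ltW a0)//; lra.
- exact: cmod_estr_le1.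
Qed.

Lemma cmod_i (z : R[i]) : cmod ('i * z) = cmod z.
Proof.
rewrite cmodM (_ : cmod 'i = 1) ?mul1r//.
by rewrite /cmod /= expr0n/= add0r expr1n sqrtr1.
Qed.

Lemma cmod_zpolB_ge_radius m r p : 0 < m -> 0 < r ->
  `|r - m| <= cmod (zpol m 0 - zpol r p).
Proof.
move=> m0 r0; rewrite -(@ler_pXn2r _ 2)// ?nnegrE ?cmod_ge0//.
rewrite real_normK ?num_real// cmod_zpolB subr0.
have := mulr_ge0 (ltW m0) (ltW r0); have := cos_le1 p; nra.
Qed.

Lemma cmod_zpolB_ge_angle m r p q : 0 < m -> 0 < r -> 0 <= q -> q < pi / 2 ->
  `|p| <= q -> m * cos q * `|p| <= cmod (zpol m 0 - zpol r p).
Proof.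
move=> m0 r0 q0 q1 pq; have pi0 := @pi_gt0 R.
have h : `|p| * cos q <= sin `|p| by exact: sin_ge_linear.
have [->|p0] := eqVneq p 0; first by rewrite normr0 mulr0 cmod_ge0.
have np0 : 0 < `|p| by rewrite normr_gt0.
apply: (@le_trans _ _ (m * sin `|p|)).
  by rewrite -mulrA ler_pM2l// mulrC.
apply: cmod_zpolB_ge => //; first by rewrite np0; lra.
by rewrite subr0 cos_norm.
Qed.

(** The distance from z to s controls both the radial displacement |r - m| and the angular one |p|,
    so F can be followed along an arc and then along a ray. The bound cancels the pole of the Cauchy
    kernel uniformly in p. *)
Lemma estr_lipschitz nu a m al q : 0 < nu -> nu <= 1 / 2 -> 0 < a ->
  0 < m -> 0 < q -> q < pi / 2 -> `|al| + q <= pi / 2 ->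
  exists2 K, 0 < K & forall r p, 0 < r -> r <= 2 * m -> `|p| <= q ->
    cmod (estr nu a r (al + p) - estr nu a m al) <= K * cmod (zpol m 0 - zpol r p).
Proof.
move=> nu0 nu1 a0 m0 q0 q1 alq; have pi0 := @pi_gt0 R.
have cq : 0 < cos q by apply: cos_gt0_pihalf; apply/andP; split; lra.
have range p : `|p| <= q -> - (pi / 2) <= al + p <= pi / 2.
  by move=> pq; rewrite -ler_norml (le_trans (ler_normD _ _))//; lra.
have ral : - (pi / 2) <= al <= pi / 2 by have := range 0; rewrite normr0 addr0; apply; exact: ltW.
have mcq : 0 < m * cos q by rewrite mulr_gt0.
pose A := a * (1 + 2 * m).
have A0 : 0 < A by rewrite /A mulr_gt0// ltr_pwDl// mulr_ge0// ltW.
(* [A] bounds |z F'(z)| for |z| <= 2 m. The first summand pays for the arc, where |p| is at most the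
   distance divided by m cos q; the second pays for the radial segment, in both cases distinguished
   below. *)
exists (2 * A / (m * cos q) + 4 * (A + 1) / m).
  by rewrite addr_gt0// divr_gt0// mulr_gt0// addr_gt0.
move=> r p r0 r2m pq; set w := cmod (zpol m 0 - zpol r p).
have w0 : 0 <= w by exact: cmod_ge0.
have wr : `|r - m| <= w by exact: cmod_zpolB_ge_radius.
have wp : m * cos q * `|p| <= w by apply: cmod_zpolB_ge_angle => //; exact: ltW.
have XA u v : 0 < u -> u <= 2 * m -> - (pi / 2) <= v <= pi / 2 ->
    cmod (estrX nu a u v) <= A.
  by move=> u0 u2 hv; rewrite (le_trans (cmod_estrX _ _ _ _ hv))// ler_pM2l// lerD2l.
have -> : estr nu a r (al + p) - estr nu a m al =
   (estr nu a r (al + p) - estr nu a r al) + (estr nu a r al - estr nu a m al) by ring.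
rewrite (le_trans (cmodD _ _))// mulrDl; apply: lerD.
  apply: (@le_trans _ _ (2 * A * `|p|)).
    have := @cderive_lipschitz _ (estr nu a r) (fun z => 'i * estrX nu a r z) al (al + p) A.
    rewrite [al + p - al]addrC addKr; apply.
      by move=> z _; have [] := phol_estr nu a z r0.
    move=> z /andP[z1 z2]; rewrite cmod_i; apply: XA => //.
    have := range p pq => /andP[h1 h2]; move: ral => /andP[h3 h4].
    apply/andP; split.
      by rewrite (le_trans _ z1)// le_min h3.
    by rewrite (le_trans z2)// ge_max h4.
  have : `|p| <= w / (m * cos q) by rewrite ler_pdivlMr// mulrC.
  move/(ler_wpM2l (ltW (mulr_gt0 (ltr0Sn R 1) A0))) => /le_trans; apply.
  by rewrite mulrA mulrAC.
apply: (@le_trans _ _ (4 * (A + 1) / m * `|r - m|)); last first.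
  by rewrite ler_wpM2l// divr_ge0 ?(ltW m0)// mulr_ge0// ltW// addr_gt0.
(* The radial derivative z F'(z) / r need not stay bounded as r tends to 0. For r < m / 2 one has |r
   - m| > m / 2, and the trivial bound 2 on the difference suffices. *)
have [rm|rm] := leP (m / 2) r.
  have := @cderive_lipschitz _ (estr nu a ^~ al) (fun z => estrX nu a z al / z%:C) m r (2 * A / m).
  move=> /(_ _ _)/le_trans; apply.
  - move=> z /andP[z1 _]; have z0 : 0 < z.
      by rewrite (lt_le_trans _ z1)// lt_min m0 r0.
    by have [] := phol_estr nu a al z0.
  - move=> z /andP[z1 z2]; have zm : m / 2 <= z.
      by rewrite (le_trans _ z1)// le_min rm andbT; lra.
    have z0 : 0 < z by lra.
    rewrite cmodM cmodV cmod_real gtr0_norm// ler_pdivrMr//.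
    apply: (@le_trans _ _ A).
      by apply: XA => //; rewrite (le_trans z2)// ge_max r2m andbT; lra.
    by rewrite mulrAC ler_pdivlMr//; nra.
  - rewrite ler_wpM2r// [leLHS]mulrA ler_wpM2r// ?invr_ge0 ?(ltW m0)//.
    by lra.
apply: (@le_trans _ _ 2).
  rewrite (le_trans (cmodD _ _))// cmodN (_ : 2 = 1 + 1)//.
  by apply: lerD; exact: cmod_estr_le1.
rewrite distrC gtr0_norm; last by lra.
by rewrite mulrAC ler_pdivlMr//; nra.
Qed.

End KernelBounds.

(** * The jump of the Cauchy integral across the ray through s *)

Section RayJump.
Context {R : realType}.
Implicit Types (nu a c r th x y t m p : R).
Notation mu := (@lebesgue_measure R).
Notation RP := (`]0, +oo[%classic : set R).

Lemma cderive_comp (f : R -> R[i]) (h : R -> R) (x dh : R) (df : R[i]) :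
  cderive f (h x) df -> is_derive x 1 h dh ->
  cderive (fun u => f (h u)) x (df * dh%:C).
Proof.
move=> [f1 f2] hh; split.
  apply: is_derive_eq (is_derive1_comp f1 hh) _.
  by rewrite [in RHS]mulrC cReRM mulrC.
apply: is_derive_eq (is_derive1_comp f2 hh) _.
by rewrite [in RHS]mulrC cImRM mulrC.
Qed.

Lemma cvg_seq_unique (u : nat -> R) x y :
  u n @[n --> \oo] --> x -> u n @[n --> \oo] --> y -> x = y.
Proof. by move=> h1 h2; rewrite -(cvg_lim _ h1)// -(cvg_lim _ h2). Qed.

Lemma cmod_kap m r p : cmod (kap m r p) = (cmod (zpol m 0 - zpol r p))^-1.
Proof. by rewrite /kap cmodM cmod_cis mul1r cmodV. Qed.

Lemma cderive_kap0 m r : 0 < r -> r != m ->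
  exists d, cderive (fun p => kap m r p) 0 d.
Proof.
move=> r0 rm; eexists.
apply: (@cderiveM _ (fun p => cis p) (fun p => (zpol m 0 - zpol r p)^-1)).
  by have := @cderive_cis R 1 0; under eq_fun do rewrite mul1r; apply.
apply: cderiveV.
  have -> : zpol m 0 - zpol r 0 = (m - r)%:C.
    by rewrite /zpol cisE cos0 sin0; apply: complex_ext => /=; ring.
  by rewrite -cmod_eq0 cmod_real normr_eq0 subr_eq0 eq_sym.
by have [h _] := @phol_zpolB R (zpol m 0) r 0 (lt0r_neq0 r0); exact: h.
Qed.

(** This is the residue theorem at s. The two half-lines are first turned to the angles al + p and
    al - p; the limit p -> 0 is then taken in an integral from which F(s) has been removed. *)
Lemma hray_jump nu a m al : 0 < nu -> nu <= 1 / 2 -> 0 < a -> 0 < m ->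
  - (pi / 2) < al < pi / 2 ->
  hray nu a (zpol m al) (pi / 2) - hray nu a (zpol m al) (- (pi / 2)) =
  estr nu a m al * (0 +i* (2 * pi)).
Proof.
move=> nu0 nu1 a0 m0 hal; have pi0 := @pi_gt0 R.
have al1 : `|al| < pi / 2 by rewrite ltr_norml.
have [al2 al3] := andP hal.
set s := zpol m al; set Fs := estr nu a m al.
(* Half the angular gap between s and the imaginary axis: for p <= q both rays stay in the right
   half-plane. *)
pose q := (pi / 2 - `|al|) / 2.
have nal := normr_ge0 al.
have q0 : 0 < q by rewrite /q; lra.
have q1 : q < pi / 2 by rewrite /q; lra.
have alq : `|al| + q <= pi / 2 by rewrite /q; lra.
have range p : `|p| <= q -> - (pi / 2) <= al + p <= pi / 2.
  by move=> pq; rewrite -ler_norml (le_trans (ler_normD _ _))//; lra.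
pose g p r := estr nu a r (al + p) * kap m r p.
have hg p : hray nu a s (al + p) = cint (g p).
  by apply: eq_cint => r _; rewrite mulrCA kapE.
pose c := a * cos (pi / 4).
have c0 : 0 < c by rewrite mulr_gt0// cos_gt0_pihalf//; lra.
have [C C0 hC] := stretched_exp_bd nu0 c0.
have Ebd r p : 0 < r -> `|p| <= q -> cmod (estr nu a r (al + p)) <= cauchy_bd C r.
  move=> r0 pq; rewrite (le_trans (cmod_estr_le _ _ _ _ (range p pq)))//.
  by rewrite (le_trans _ (hC r r0))// ler_peMl ?expR_ge0// lerDl ltW.
have pm p : 0 < p <= q -> [/\ 0 < p < pi, `|p| <= q & `|- p| <= q].
  by move=> /andP[p0 pq]; rewrite normrN gtr0_norm// p0 pq; split=> //; lra.
have wge r p' p : 0 < r -> 0 < p <= q -> (p' == p) || (p' == - p) -> m * sin p <= cmod (zpol m 0 - zpol r p').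
  move=> r0 /pm[hp _ _] hh; apply: cmod_zpolB_ge => //.
  by case/orP: hh => /eqP ->; rewrite subr0 ?cosN.
have wgt r p' p : 0 < r -> 0 < p <= q -> (p' == p) || (p' == - p) -> 0 < cmod (zpol m 0 - zpol r p').
  move=> r0 hp hh; apply: lt_le_trans (wge r p' p r0 hp hh).
  by have [hp' _ _] := pm p hp; rewrite mulr_gt0// sin_gt0_pi.
have ig p' p : 0 < p <= q -> (p' == p) || (p' == - p) -> cintegrable (g p').
  move=> hp hh; have [hp' pq pNq] := pm p hp.
  have p'q : `|p'| <= q by case/orP: hh => /eqP ->.
  have ms0 : 0 < m * sin p by rewrite mulr_gt0// sin_gt0_pi.
  apply: (@cintegrable_bd _ _ (C / (m * sin p))) => r r0.
    have [_ h1] := phol_estr nu a (al + p') r0.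
    have [_ h2] := @phol_zpolB R (zpol m 0) r p' (lt0r_neq0 r0).
    have w0 : zpol m 0 - zpol r p' != 0 by rewrite -cmod_eq0 lt0r_neq0// (wgt r p' p).
    apply: cderive_continuous.
    exact: (cderiveM h1 (cderiveM (cderive_cst (cis p') r) (@cderiveV _ (fun r => zpol m 0 - zpol r p') _ _ w0 h2))).
  rewrite /g cmodM cmod_kap.
  have -> : cauchy_bd (C / (m * sin p)) r = cauchy_bd C r * (m * sin p)^-1.
    by rewrite /cauchy_bd mulrAC.
  apply: ler_pM; rewrite ?cmod_ge0 ?invr_ge0 ?cmod_ge0//; first exact: Ebd.
  by rewrite lef_pV2 ?posrE// ?(wge r p' p)// (wgt r p' p).
pose pc p r : R[i] := 0 +i* (2 * poisson m r p).
have ipc p : 0 < p <= q -> cintegrable (pc p) /\ cint (pc p) = 0 +i* (2 * (pi - p)).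
  move=> /pm[hp _ _]; have [h1 h2] := integral_poisson m0 hp.
  have h3 : cintegrable (fun r => (poisson m r p)%:C).
    by split => //=; exact: integrable0.
  have -> : pc p = fun r => (0 +i* 2) * (poisson m r p)%:C.
    by apply/funext => r; apply: complex_ext => /=; ring.
  have [h4 ->] := cintZ (0 +i* 2) h3; split => //.
  apply: complex_ext; rewrite /cint /= h2 /Rintegral integral0 /=; ring.
(* Subtracting [Fs] on both rays removes [Fs] times the difference of the kernels, that is, times 2i
   times the Poisson kernel. *)
pose D p r := (estr nu a r (al + p) - Fs) * kap m r p
            - (estr nu a r (al + - p) - Fs) * kap m r (- p).
have DE p r : 0 < p <= q -> D p r = g p r - g (- p) r - Fs * pc p r.
  move=> /pm[hp _ _]; rewrite /D /g /pc -(kapB r m0 hp).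
  by move: (estr _ _ _ _) (estr _ _ _ (al - p)) (kap _ _ _) (kap _ _ (- p)) => u v w z; ring.
pose J := hray nu a s (pi / 2) - hray nu a s (- (pi / 2)) - Fs * (0 +i* (2 * pi)).
(* [J] is the defect of the claimed identity. It does not depend on p, and the term in 2 p comes
   from the Poisson mass pi - p. *)
have iD p : 0 < p <= q -> cintegrable (D p) /\ cint (D p) = J + Fs * (0 +i* (2 * p)).
  move=> hp; have [hp1 pq pNq] := pm p hp; have [p0 p1] := andP hp.
  have -> : D p = (fun r => g p r - g (- p) r - Fs * pc p r) by apply/funext => r; exact: DE.
  have ig1 : cintegrable (g p) by apply: (ig _ p) => //; rewrite eqxx.
  have ig2 : cintegrable (g (- p)) by apply: (ig _ p) => //; rewrite eqxx orbT.
  have [ip1 ip2] := ipc p hp.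
  have [i1 e1] := cintB ig1 ig2; have [i2 e2] := cintZ Fs ip1.
  have [i3 ->] := cintB i1 i2; split => //.
  rewrite e1 e2 ip2 -!hg /J.
  have [ra1 ra2] := andP (range p pq); have [rb1 rb2] := andP (range (- p) pNq).
  have -> : hray nu a s (pi / 2) = hray nu a s (al + p).
    apply: (@hray_rotation _ _ _ _ _ p) => //.
    by move=> th /andP[h1 h2]; apply: le_cos; lra.
  have -> : hray nu a s (- (pi / 2)) = hray nu a s (al + - p).
    apply/esym; apply: (@hray_rotation _ _ _ _ _ p) => //.
    by move=> th /andP[h1 h2]; rewrite -cosN; apply: le_cos; lra.
  have -> : 0 +i* (2 * (pi - p)) = (0 +i* (2 * pi)) - (0 +i* (2 * p)) :> R[i].
    by apply: complex_ext => /=; ring.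
  by move: (hray _ _ _ _) (hray _ _ _ (al - p)) (_ +i* _) (_ +i* (2 * p)) => u v w z; ring.
have [K K0 hK] := estr_lipschitz nu0 nu1 a0 m0 q0 q1 alq.
(* The first summand serves r <= 2 m, where each of the two quotients is at most [K]. The rest
   serves r > 2 m: there |s - z| >= m, so the decay of F gives C / m for each ray, and the Poisson
   denominator is at least r^2 / 4. *)
pose CT := 2 * K * (1 + 4 * m ^+ 2) + (2 * (C / m) + (2 / m + 8 * m)).
have Dbd p r : 0 < p <= q -> 0 < r -> cmod (D p r) <= cauchy_bd CT r.
  move=> hp r0; have [hp1 pq pNq] := pm p hp.
  rewrite /cauchy_bd ler_pdivlMr ?add1_sqr_gt0//.
  have [rm|rm] := leP r (2 * m).
    have t1 p' : (p' == p) || (p' == - p) ->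
        cmod ((estr nu a r (al + p') - Fs) * kap m r p') <= K.
      move=> hh; have p'q : `|p'| <= q by case/orP: hh => /eqP ->.
      by rewrite cmodM cmod_kap ler_pdivrMr ?(wgt r p' p)// hK.
    have r2 : r ^+ 2 <= 4 * m ^+ 2 by rewrite !expr2; nra.
    have h1 : cmod (D p r) <= 2 * K.
      rewrite (le_trans (cmodD _ _))// cmodN (_ : 2 * K = K + K); last by ring.
      by apply: lerD; apply: t1; rewrite eqxx ?orbT.
    apply: (@le_trans _ _ (2 * K * (1 + 4 * m ^+ 2))).
      by rewrite ler_pM ?cmod_ge0// ?addr_ge0 ?sqr_ge0// lerD2l.
    rewrite lerDl addr_ge0 ?mulr_ge0 ?divr_ge0 ?addr_ge0 ?mulr_ge0 ?divr_ge0 ?invr_ge0 ?(ltW m0) ?(ltW C0)//.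
  rewrite DE// ; have D0 := add1_sqr_gt0 r.
  have t1 p' : (p' == p) || (p' == - p) -> cmod (g p' r) <= C / (1 + r ^+ 2) / m.
    move=> hh; have p'q : `|p'| <= q by case/orP: hh => /eqP ->.
    rewrite /g cmodM cmod_kap; apply: ler_pM; rewrite ?cmod_ge0 ?invr_ge0 ?cmod_ge0//; first exact: Ebd.
    rewrite lef_pV2 ?posrE// ?(wgt r p' p)//.
    rewrite (le_trans _ (cmod_zpolB_ge_radius _ _ _))//.
    by rewrite ger0_norm; lra.
  have t2 : cmod (Fs * pc p r) <= (2 / m + 8 * m) / (1 + r ^+ 2).
    rewrite cmodM -[leRHS]mul1r; apply: ler_pM; rewrite ?cmod_ge0//.
      by apply: cmod_estr_le1 => //; rewrite (ltW al2) (ltW al3).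
    have [p0 ppi] := andP hp1.
    have P0 := poisson_den_gt0 r m0 hp1.
    have P1 : r ^+ 2 / 4 <= m ^+ 2 - 2 * m * r * cos p + r ^+ 2.
      have := mulr_ge0 (ltW m0) (ltW r0); have := cos_le1 p; rewrite !expr2; nra.
    have s1 : 0 < sin p by exact: sin_gt0_pi.
    have s2 := sin_le1 p.
    have -> : cmod (pc p r) = 2 * poisson m r p.
      rewrite /cmod /= expr0n/= add0r sqrtr_sqr ger0_norm// mulr_ge0// divr_ge0 ?(ltW P0)//.
      by rewrite mulr_ge0 ?ltW.
    rewrite /poisson ler_pdivlMr// mulrA mulrAC ler_pdivrMr//.
    apply: (@le_trans _ _ ((2 / m + 8 * m) * (r ^+ 2 / 4))); last first.
      by rewrite ler_wpM2l// addr_ge0 ?mulr_ge0 ?invr_ge0 ?(ltW m0).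
    apply: (@le_trans _ _ (2 * m * (1 + r ^+ 2))).
      by rewrite ler_wpM2r ?(ltW D0)// mulrA ler_piMr// mulr_ge0// ltW.
    have r2 : m <= r ^+ 2 / (4 * m) by rewrite ler_pdivlMr ?mulr_gt0// !expr2; nra.
    have -> : (2 / m + 8 * m) * (r ^+ 2 / 4) = 2 * (r ^+ 2 / (4 * m)) + 2 * m * r ^+ 2.
      by field; rewrite gt_eqF.
    by rewrite mulrDr mulr1 lerD2r ler_pM2l.
  rewrite -ler_pdivlMr//.
  apply: (@le_trans _ _ ((2 * (C / m) + (2 / m + 8 * m)) / (1 + r ^+ 2))); last first.
    by rewrite ler_wpM2r ?invr_ge0 ?(ltW D0)// lerDr mulr_ge0 ?mulr_ge0 ?(ltW K0)// addr_ge0// mulr_ge0// sqr_ge0.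
  rewrite mulrDl (le_trans (cmodD _ _))// lerD// ?cmodN//.
  rewrite (_ : 2 * (C / m) / (1 + r ^+ 2) = C / (1 + r ^+ 2) / m + C / (1 + r ^+ 2) / m); last first.
    by field; rewrite !gt_eqF.
  by rewrite (le_trans (cmodD _ _))// lerD ?cmodN// t1// eqxx ?orbT.
(* Away from the pole [D] is continuous in p, and at p = 0 its two terms coincide. *)
have Dlim r : 0 < r -> r != m -> ccontinuous_at (fun p => D p r) 0 /\ D 0 r = 0.
  move=> r0 rm; split; last by rewrite /D oppr0 subrr.
  have [dk hk] := cderive_kap0 r0 rm.
  have hN : is_derive (0 : R) (1 : R) (fun u : R => - u) (-1) by exact: is_deriveNid.
  have h1 : is_derive (0 : R) (1 : R) (fun u : R => al + u) 1.
    apply: (is_derive_eqf (is_deriveD (is_derive_cst al (0 : R) (1 : R)) (is_derive_id (0 : R) (1 : R)))) => //.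
    by rewrite add0r.
  have h2 : is_derive (0 : R) (1 : R) (fun u : R => al + - u) (-1).
    apply: (is_derive_eqf (is_deriveD (is_derive_cst al (0 : R) (1 : R)) hN)) => //.
    by rewrite add0r.
  have e1 x : cderive (fun p => estr nu a r p) x ('i * estrX nu a r x).
    by have [] := phol_estr nu a x r0.
  have t1 (h : R -> R) dh : is_derive (0 : R) (1 : R) (fun u : R => al + h u) dh ->
      is_derive (0 : R) (1 : R) h dh -> h 0 = 0 ->
      exists d, cderive (fun p => (estr nu a r (al + h p) - Fs) * kap m r (h p)) 0 d.
    move=> i1 i2 h00; eexists.
    apply: (@cderiveM _ (fun p => estr nu a r (al + h p) - Fs) (fun p => kap m r (h p))).
      apply: (@cderiveD _ (fun p => estr nu a r (al + h p)) (fun=> - Fs)); last exact: cderive_cst.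
      by apply: cderive_comp i1; exact: e1.
    by apply: cderive_comp i2; rewrite h00; exact: hk.
  have [d1 k1] := t1 id 1 h1 (is_derive_id _ _) erefl.
  have [d2 k2] := t1 -%R (-1) h2 hN (oppr0 _).
  have := cderiveD k1 (cderiveM (cderive_cst (-1) 0) k2).
  have -> : D ^~ r = fun p => (estr nu a r (al + id p) - Fs) * kap m r (id p) +
       -1 * ((estr nu a r (al - p) - Fs) * kap m r (- p)).
    by apply/funext => p; rewrite mulN1r.
  exact: cderive_continuous.
pose pn n := q * n.+1%:R^-1.
have pn0 n : 0 < pn n <= q.
  by rewrite mulr_gt0 ?invr_gt0//= ler_piMr ?(ltW q0)// invf_le1// ler1n.
have pnlim : pn n @[n --> \oo] --> (0 : R).
  rewrite -[X in _ --> X](mulr0 q); apply: cvgM; [exact: cvg_cst|exact: cvg_harmonic].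
(* [P] stands for the real or the imaginary part; [y] is the real factor by which [P] sees
   multiplication of [Fs] by i x, namely - Im Fs or Re Fs. *)
have rest (P : R[i] -> R) (y : R) : (forall z, `|P z| <= cmod z) ->
    (forall r, 0 < r -> r != m -> {for 0, continuous (fun p => P (D p r))}) ->
    (forall p, 0 < p <= q -> P (cint (D p)) = \int[mu]_(r in RP) P (D p r)) ->
    (forall p, 0 < p <= q -> mu.-integrable RP (EFin \o (fun r => P (D p r)))) ->
    P 0 = 0 -> (forall x, P (J + Fs * (0 +i* x)) = P J + y * x) -> P J = 0.
  move=> Pb Pc Pi Pm P0 PJ.
  have l1 : \int[mu]_(r in RP) P (D (pn n) r) @[n --> \oo] --> 0.
    apply: (@dominated_cvg0 _ _ CT m).
    - by move=> n; have /measurable_int/measurable_EFinP := Pm _ (pn0 n).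
    - by move=> n r r0; rewrite (le_trans (Pb _))// Dbd.
    - move=> r r0 rm; have [_ D0] := Dlim r r0 rm.
      rewrite -P0 -D0; exact: (cvg_comp _ _ pnlim (Pc r r0 rm)).
  have l2 : P J + y * (2 * pn n) @[n --> \oo] --> P J + y * (2 * 0).
    apply: cvgD; first exact: cvg_cst.
    apply: cvgM; first exact: cvg_cst.
    by apply: cvgM; [exact: cvg_cst|exact: pnlim].
  have e n : \int[mu]_(r in RP) P (D (pn n) r) = P J + y * (2 * pn n).
    by rewrite -Pi// (iD _ (pn0 n)).2 PJ.
  move: l1; under eq_fun do rewrite e.
  move=> l1; have := cvg_seq_unique l2 l1.
  by rewrite !mulr0 addr0.
have J0 : J = 0.
  apply: complex_ext => /=.
    apply: (rest (@complex.Re R) (- complex.Im Fs)) => //.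
    - exact: Re_le_cmod.
    - by move=> r r0 rm; have [[]] := Dlim r r0 rm.
    - by move=> p hp; have [[]] := iD p hp.
    - by move=> x; rewrite cReD cReM /=; ring.
  apply: (rest (@complex.Im R) (complex.Re Fs)) => //.
  - exact: Im_le_cmod.
  - by move=> r r0 rm; have [[]] := Dlim r r0 rm.
  - by move=> p hp; have [[]] := iD p hp.
  - by move=> x; rewrite cImD cImM /=; ring.
by move: J0; rewrite /J => /eqP; rewrite subr_eq0 => /eqP.
Qed.

End RayJump.

(** * Laplace transform of the inversion integral *)

Section LaplaceFourier.
Context {R : realType}.
Implicit Types (nu a c r th x y t m p : R).
Notation mu := (@lebesgue_measure R).
Notation RP := (`]0, +oo[%classic : set R).

(** Since [f] is assumed integrable, the limit of the primitive along the integers determines the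
    integral. *)
Lemma integral_halfline_lim (F f : R -> R) (l : R) :
  (forall t : R, 0 <= t -> is_derive t 1 F (f t)) ->
  (forall t, 0 <= t -> {for t, continuous f}) ->
  mu.-integrable RP (EFin \o f) ->
  F n%:R @[n --> \oo] --> l ->
  \int[mu]_(t in `]0, +oo[) f t = l - F 0.
Proof.
move=> dF cf intf Fl.
pose f_ n := (f \_ `[0, n.+1%:R]).
have lim1 : (\int[mu]_(r in RP) (f_ n r)%:E)%E @[n --> \oo] -->
    (\int[mu]_(r in RP) (f r)%:E)%E.
  apply: (@dominated_cvg _ _ _ mu RP _ (fun n r => (f_ n r)%:E) (EFin \o f) (EFin \o (fun r => `|f r|))) => //.
  - move=> n; apply/measurable_EFinP; apply/measurable_restrict => //.
    have /measurable_int/measurable_EFinP := intf.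
    by apply: measurable_funS => //; exact: subIsetl.
  - move=> r; rewrite /= in_itv/= andbT => r0; apply: cvg_EFin; first exact: nearW.
    apply: cvg_near_cst; near=> n.
    rewrite /= /f_ /= patchE mem_set//= in_itv/= (ltW r0)/=.
    rewrite (le_trans (ltW (truncnS_gt _)))// ler_nat ltnS.
    by near: n; exact: nbhs_infty_ge.
  - have := integrable_abse intf.
    by apply: eq_integrable => // r _ /=.
  - move=> n r; rewrite /= in_itv/= andbT => r0; rewrite lee_fin /f_ patchE.
    by case: ifP => _ //; rewrite normr0.
have int_f n : \int[mu]_(r in RP) f_ n r = F n.+1%:R - F 0.
  transitivity (\int[mu]_(x in `[0, n.+1%:R]) f x).
    rewrite -Rintegral_itv_obnd_cbnd.
      rewrite -Rintegral_mkcondr; congr (Rintegral _ _ _).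
      apply/seteqP; split => r /=; rewrite !in_itv/= ?andbT; first by case=> -> /andP[].
      by move=> /andP[r0 ->]; rewrite r0 ltW.
    apply: integrableS intf => //.
    by move=> r /=; rewrite !in_itv/= => /andP[->].
  apply: FTC2_derive => // r /andP[r0 _].
    exact: dF.
  exact: cf.
have finf : (\int[mu]_(r in RP) (f r)%:E)%E \is a fin_num by exact: integrable_fin_num.
rewrite -(fineK finf) in lim1; have {}lim1 := fine_cvg lim1.
have l1 : (fun n => F n.+1%:R - F 0) @ \oo --> \int[mu]_(r in RP) f r.
  by under eq_fun do rewrite -int_f; exact: lim1.
have l2 : (fun n => F n.+1%:R - F 0) @ \oo --> l - F 0.
  apply: cvgB; last exact: cvg_cst.
  by move: Fl; rewrite -(cvg_shiftS (fun n => F n%:R)).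
exact: cvg_seq_unique l1 l2.
Unshelve. all: by end_near. Qed.

Lemma cmod_cint (g : R -> R[i]) (C : R) :
  (forall r, 0 < r -> ccontinuous_at g r) ->
  (forall r, 0 < r -> cmod (g r) <= cauchy_bd C r) ->
  cmod (cint g) <= 2 * \int[mu]_(r in RP) cauchy_bd C r.
Proof.
move=> cg gC; have [i1 i2] := cintegrable_bd cg gC.
have h (f : R -> R) : mu.-integrable RP (EFin \o f) ->
   (forall r, 0 < r -> `|f r| <= cauchy_bd C r) ->
   `|\int[mu]_(r in RP) f r| <= \int[mu]_(r in RP) cauchy_bd C r.
  move=> fi fC; rewrite (le_trans (le_normr_Rintegral _ fi))//.
  apply: le_Rintegral => //.
  - have := integrable_abse fi.
    by apply: eq_integrable => // r _ /=.
  - exact: integrable_cauchy_bd.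
  - by move=> r /=; rewrite in_itv/= andbT; exact: fC.
rewrite (le_trans (cmod_le _))// (_ : 2 * _ = \int[mu]_(r in RP) cauchy_bd C r + \int[mu]_(r in RP) cauchy_bd C r); last by ring.
by apply: lerD; apply: h => // r r0; rewrite (le_trans _ (gC r r0))// ?Re_le_cmod ?Im_le_cmod.
Qed.

Lemma ccontinuousM (f g : R -> R[i]) x : ccontinuous_at f x -> ccontinuous_at g x ->
  ccontinuous_at (fun u => f u * g u) x.
Proof.
move=> [f1 f2] [g1 g2]; split.
  have -> : (fun u => complex.Re (f u * g u)) = (fun u => complex.Re (f u) * complex.Re (g u) - complex.Im (f u) * complex.Im (g u)).
    by apply/funext => u; rewrite cReM.
  by apply: cvgB; apply: cvgM.
have -> : (fun u => complex.Im (f u * g u)) = (fun u => complex.Re (f u) * complex.Im (g u) + complex.Im (f u) * complex.Re (g u)).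
  by apply/funext => u; rewrite cImM.
by apply: cvgD; apply: cvgM.
Qed.

Lemma cderive_under_integral (P dP : R -> R -> R[i]) (x u v C : R) :
  u < x < v ->
  (forall r x, 0 < r -> u < x < v -> cderive (P r) x (dP r x)) ->
  (forall r x, 0 < r -> u < x < v -> ccontinuous_at (P ^~ x) r) ->
  (forall r x, 0 < r -> u < x < v -> cmod (P r x) <= cauchy_bd C r) ->
  (forall r x, 0 < r -> u < x < v -> cmod (dP r x) <= cauchy_bd C r) ->
  cderive (fun x => cint (P ^~ x)) x (cint (dP ^~ x)).
Proof.
move=> uxv dP1 cP PC dPC; split.
  apply: (@is_derive_under_integral _ (fun r x => complex.Re (P r x)) (fun r x => complex.Re (dP r x)) x u v C) => //.
  - by move=> r y r0 hy; have [] := dP1 r y r0 hy.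
  - by move=> r y r0 hy; have [] := cP r y r0 hy.
  - by move=> r y r0 hy; rewrite (le_trans (Re_le_cmod _))// PC.
  - by move=> r y r0 hy; rewrite (le_trans (Re_le_cmod _))// dPC.
apply: (@is_derive_under_integral _ (fun r x => complex.Im (P r x)) (fun r x => complex.Im (dP r x)) x u v C) => //.
- by move=> r y r0 hy; have [] := dP1 r y r0 hy.
- by move=> r y r0 hy; have [] := cP r y r0 hy.
- by move=> r y r0 hy; rewrite (le_trans (Im_le_cmod _))// PC.
- by move=> r y r0 hy; rewrite (le_trans (Im_le_cmod _))// dPC.
Qed.

Lemma cderive_lin (z : R[i]) x : cderive (fun u => z * u%:C) x z.
Proof.
apply: cderive_eq (cderiveM (cderive_cst z x) (cderive_real (is_derive_id x 1))) _.
by rewrite mul0r add0r mulr1.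
Qed.

(** * Laplace transform of a Fourier integral over one half-line *)

Section OneFrequency.
Variables (w : R -> R[i]) (C eps : R) (s : R[i]).
Hypothesis cw : forall r, 0 < r -> ccontinuous_at w r.
Hypothesis wC : forall r, 0 < r -> cmod (w r) <= cauchy_bd C r.
Hypothesis s0 : 0 < complex.Re s.

(** The factors e^(-st) and e^(i eps t r) combine into e^(-lam t), whose rate has the real part of s
    for every r. The section is applied with [eps] = 1 and [eps] = -1, for the upper and the lower
    half-line. *)
Let lam r : R[i] := s - 'i * (eps * r)%:C.
Let sg : R := complex.Re s.

Let lamRe r : complex.Re (lam r) = sg.
Proof. by rewrite /lam cReD cReN cReM /= mul0r mulr0 subr0 subr0. Qed.

Let lam_ge r : sg <= cmod (lam r).
Proof. by rewrite -(lamRe r) (le_trans (ler_norm _))// Re_le_cmod. Qed.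

Let lam_neq0 r : lam r != 0.
Proof. by rewrite -cmod_eq0 lt0r_neq0// (lt_le_trans s0). Qed.

Let ex t r : R[i] := cexp (- lam r * t%:C).

Let cmod_ex t r : cmod (ex t r) = expR (- (sg * t)).
Proof. by rewrite cmod_cexp mulrC cReRM cReN lamRe mulrN mulrC. Qed.

Let ex_fact t r : ex t r = cexp (- (s * t%:C)) * cis (eps * (t * r)).
Proof.
rewrite -cexp_imag -cexpD; congr cexp; rewrite /lam; apply: complex_ext.
  by rewrite !(cReM, cReN, cReD) /=; ring.
by rewrite !(cImM, cImN, cImD) /=; ring.
Qed.

Let cderive_lam r : exists d, cderive lam r d.
Proof.
eexists; apply: (@cderiveD _ (fun=> s) (fun r => - ('i * (eps * r)%:C))).
  exact: cderive_cst.
have -> : (fun r => - ('i * (eps * r)%:C)) = (fun r => (- 'i * eps%:C) * r%:C) :> (R -> R[i]).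
  by apply/funext => u; rewrite rmorphM/= mulrA !mulNr.
exact: cderive_lin.
Qed.

Let cont_ex t r : ccontinuous_at (ex t) r.
Proof.
have [d hd] := cderive_lam r.
have h := cderive_exp (cderiveM (cderiveM (cderive_cst (-1) r) hd) (cderive_cst t%:C r)).
have -> : ex t = (fun u => cexp (-1 * lam u * t%:C)).
  by apply/funext => u; rewrite mulN1r.
exact: cderive_continuous h.
Qed.

Let cont_lamV r : ccontinuous_at (fun r => (lam r)^-1) r.
Proof.
by have [d hd] := cderive_lam r; apply: cderive_continuous (cderiveV (lam_neq0 r) hd).
Qed.

Let f t := cint (fun r => ex t r * w r).

Lemma laplace_fourier_cintegrand t :
  cexp (- (s * t%:C)) * cint (fun r => cis (eps * (t * r)) * w r) = f t.
Proof.
have ci : cintegrable (fun r => cis (eps * (t * r)) * w r).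
  apply: (@cintegrable_bd _ _ C) => r r0; last by rewrite cmodM cmod_cis mul1r wC.
  apply: ccontinuousM; last exact: cw.
  have -> : (fun u => cis (eps * (t * u))) = (fun u => cis (eps * t * u)) :> (R -> R[i]).
    by apply/funext => u; rewrite mulrA.
  exact: cderive_continuous (cderive_cis _ _).
have [_ <-] := cintZ (cexp (- (s * t%:C))) ci.
by apply: eq_cint => r _; rewrite mulrA -ex_fact.
Qed.

Let I := 2 * \int[mu]_(r in RP) cauchy_bd C r.

Let int_bd (k : R) : 2 * \int[mu]_(r in RP) cauchy_bd (k * C) r = k * I.
Proof.
have -> : cauchy_bd (k * C) = (fun r => k * cauchy_bd C r).
  by apply/funext => r; rewrite /cauchy_bd mulrA.
by rewrite RintegralZl// /I ?mulrA 1?[2 * k]mulrC//; exact: integrable_cauchy_bd.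
Qed.

Let C0 : 0 <= C.
Proof.
have := le_trans (cmod_ge0 _) (wC ltr01).
by rewrite /cauchy_bd pmulr_lge0// invr_gt0 add1_sqr_gt0.
Qed.

Let I0 : 0 <= I.
Proof.
rewrite mulr_ge0//; apply: Rintegral_ge0 => r _.
by rewrite divr_ge0// ltW// add1_sqr_gt0.
Qed.

Let bdM (k : R) r : k * cauchy_bd C r = cauchy_bd (k * C) r.
Proof. by rewrite /cauchy_bd mulrA. Qed.

Let cont_exw t r : 0 < r -> ccontinuous_at (fun r => ex t r * w r) r.
Proof. by move=> r0; apply: ccontinuousM; [exact: cont_ex|exact: cw]. Qed.

Let bd_exw t r : 0 < r -> cmod (ex t r * w r) <= cauchy_bd (expR (- (sg * t)) * C) r.
Proof. by move=> r0; rewrite cmodM cmod_ex -bdM ler_pM2l ?expR_gt0// wC. Qed.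

Let f_bd t : cmod (f t) <= expR (- (sg * t)) * I.
Proof.
rewrite -int_bd; apply: cmod_cint => r r0; [exact: cont_exw|exact: bd_exw].
Qed.

Let ex_local t y r : t - 1 < y < t + 1 -> cmod (ex y r) <= expR (sg * (`|t| + 1)).
Proof.
move=> /andP[y1 y2]; rewrite cmod_ex ler_expR -mulrN ler_pM2l//.
by have := ler_norm (- t); rewrite normrN; lra.
Qed.

Let cderive_ex t r : cderive (fun t => ex t r) t (- lam r * ex t r).
Proof. exact: cderive_exp (cderive_lin (- lam r) t). Qed.

Let f_cont t : ccontinuous_at f t.
Proof.
pose M := expR (sg * (`|t| + 1)).
have Mb r y : 0 < r -> t - 1 < y < t + 1 -> cmod (ex y r * w r) <= cauchy_bd (M * C) r.
  move=> r0 hy; rewrite cmodM -bdM; apply: ler_pM; rewrite ?cmod_ge0//; last exact: wC.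
  exact: ex_local.
have cy r y : 0 < r -> ccontinuous_at (fun y => ex y r * w r) y.
  move=> r0; exact: cderive_continuous (cderiveM (cderive_ex y r) (cderive_cst (w r) y)).
have tI : t \in `]t - 1, t + 1[%classic.
  by rewrite inE/= in_itv/=; apply/andP; split; lra.
have main (P : R[i] -> R) : (forall z, `|P z| <= cmod z) ->
    (forall r y, 0 < r -> {for y, continuous (fun y => P (ex y r * w r))}) ->
    (forall r y, 0 < r -> {for r, continuous (fun r => P (ex y r * w r))}) ->
    {for t, continuous (fun y => \int[mu]_(r in RP) P (ex y r * w r))}.
  move=> Pb P1 P2.
  apply: (@continuity_under_integral R _ _ mu (fun y r => P (ex y r * w r)) RP _
    (t - 1) (t + 1) _ _ (cauchy_bd (M * C)) _ _ t tI) => //.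
  - move=> y; rewrite /= in_itv/= => hy.
    apply: (@integrable_halfline _ _ (M * C)) => r r0; first exact: P2.
    by rewrite (le_trans (Pb _))// Mb.
  - by apply: aeW => r; rewrite /= in_itv/= andbT => r0 y _; exact: P1.
  - exact: integrable_cauchy_bd.
  - move=> y; rewrite /= in_itv/= => hy; apply: aeW => r; rewrite /= in_itv/= andbT => r0.
    by rewrite (le_trans (Pb _))// Mb.
split.
  apply: main; first exact: Re_le_cmod.
    by move=> r y r0; have [] := cy r y r0.
  by move=> r y r0; have [] := cont_exw y r0.
apply: main; first exact: Im_le_cmod.
  by move=> r y r0; have [] := cy r y r0.
by move=> r y r0; have [] := cont_exw y r0.
Qed.

(* F is the primitive, vanishing at 0, of the Laplace integrand f; it replaces
   an application of Fubini's theorem. *)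
Let P r t := (1 - ex t r) * (lam r)^-1 * w r.
Let F t := cint (P ^~ t).

Let lamV_bd r : cmod (lam r)^-1 <= sg^-1.
Proof. by rewrite cmodV lef_pV2 ?posrE// (lt_le_trans s0). Qed.

Let cderive_F t : cderive F t (f t).
Proof.
pose M := expR (sg * (`|t| + 1)).
have M0 : 0 < M by exact: expR_gt0.
apply: (@cderive_under_integral P (fun r t => ex t r * w r) t (t - 1) (t + 1)
  ((1 + M) * (1 + sg^-1) * C)).
- by apply/andP; split; lra.
- move=> r y r0 _.
  have h := cderiveM (cderiveM (cderiveD (cderive_cst 1 y) (cderiveM (cderive_cst (-1) y) (cderive_ex y r)))
     (cderive_cst (lam r)^-1 y)) (cderive_cst (w r) y).
  rewrite (_ : P r = fun u => (1 + -1 * ex u r) * (lam r)^-1 * w r); last first.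
    by apply/funext => u; rewrite mulN1r.
  apply: cderive_eq h _; have := lam_neq0 r.
  by move: (lam r) (ex y r) (w r) => u v z u0; field.
- move=> r y r0 _; apply: ccontinuousM; last exact: cw.
  apply: ccontinuousM; last exact: cont_lamV.
  have [c1 c2] := cont_ex y r; split.
    rewrite (_ : (fun u => _) = (fun u => 1 - complex.Re (ex y u))); last first.
      by apply/funext => u; rewrite cReD cReN.
    by apply: cvgB; [exact: cvg_cst|exact: c1].
  rewrite (_ : (fun u => _) = (fun u => 0 - complex.Im (ex y u))); last first.
    by apply/funext => u; rewrite cImD cImN.
  by apply: cvgB; [exact: cvg_cst|exact: c2].
- move=> r y r0 hy; rewrite /P -bdM !cmodM; apply: ler_pM; rewrite ?mulr_ge0 ?cmod_ge0//; last exact: wC.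
  apply: ler_pM; rewrite ?cmod_ge0//.
    rewrite (le_trans (cmodD _ _))// cmodN -(_ : 1%:C = 1)// cmod_real normr1 lerD2l.
    exact: ex_local.
  by rewrite (le_trans (lamV_bd r))// lerDr.
- move=> r y r0 hy; rewrite -bdM cmodM; apply: ler_pM; rewrite ?cmod_ge0//; last exact: wC.
  rewrite (le_trans (ex_local _ hy))// -/M.
  have : 0 < sg^-1 by rewrite invr_gt0.
  by move: M0; nra.
Qed.

Let L := cint (fun r => (lam r)^-1 * w r).

Lemma cintegrable_resolvent :
  cintegrable (fun r => (s - 'i * (eps * r)%:C)^-1 * w r).
Proof.
apply: (@cintegrable_bd _ _ (sg^-1 * C)) => r r0.
  by apply: ccontinuousM; [exact: cont_lamV|exact: cw].
by rewrite -bdM cmodM; apply: ler_pM; rewrite ?cmod_ge0 ?wC ?lamV_bd.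
Qed.

(** The difference between [F] and its limit [L] is an integral of the same kind with the factor
    e^(-lam t) / lam, hence exponentially small. *)
Let F_L t : cmod (F t - L) <= expR (- (sg * t)) * (sg^-1 * I).
Proof.
have i1 := cintegrable_resolvent.
have c2 r : 0 < r -> ccontinuous_at (fun r => ex t r * ((lam r)^-1 * w r)) r.
  by move=> r0; apply: ccontinuousM; [exact: cont_ex|apply: ccontinuousM; [exact: cont_lamV|exact: cw]].
have b2 r : 0 < r -> cmod (ex t r * ((lam r)^-1 * w r)) <= cauchy_bd (expR (- (sg * t)) * sg^-1 * C) r.
  move=> r0; rewrite -bdM cmodM cmod_ex (cmodM (lam r)^-1) -mulrA ler_pM2l ?expR_gt0//.
  by apply: ler_pM; rewrite ?cmod_ge0 ?wC ?lamV_bd.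
have i2 := cintegrable_bd c2 b2.
have [_ e] := cintB i1 i2.
have -> : F t = L - cint (fun r => ex t r * ((lam r)^-1 * w r)).
  rewrite -e; apply: eq_cint => r _; rewrite /P.
  by move: (lam r)^-1 (ex t r) (w r) => u v z; ring.
rewrite addrAC subrr add0r cmodN mulrA -int_bd.
exact: cmod_cint c2 b2.
Qed.

Lemma laplace_fourier :
  cintegrable (fun t => cexp (- (s * t%:C)) * cint (fun r => cis (eps * (t * r)) * w r)) /\
  cint (fun t => cexp (- (s * t%:C)) * cint (fun r => cis (eps * (t * r)) * w r)) =
  cint (fun r => (s - 'i * (eps * r)%:C)^-1 * w r).
Proof.
have -> : (fun t => cexp (- (s * t%:C)) * cint (fun r => cis (eps * (t * r)) * w r)) = f.
  by apply/funext => t; exact: laplace_fourier_cintegrand.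
(* With exponent 1 the stretched exponential is the ordinary e^(-st). *)
have [C2 C20 hC2] := stretched_exp_bd (@ltr01 R) s0.
have i1 : cintegrable f.
  apply: (@cintegrable_bd _ _ (I * C2)) => t t0; first exact: f_cont.
  rewrite (le_trans (f_bd t))// mulrC.
  have -> : cauchy_bd (I * C2) t = I * cauchy_bd C2 t by rewrite /cauchy_bd mulrA.
  have := hC2 t t0; rewrite powRr1 ?(ltW t0)// => h.
  rewrite ler_wpM2l//; apply: le_trans h.
  by rewrite ler_peMl ?expR_ge0// lerDl ltW.
split => //.
have F0 : F 0 = 0.
  have -> : F 0 = cint (fun=> 0).
    apply: eq_cint => r _; rewrite /P /ex mulr0.
    have -> : cexp 0 = 1 :> R[i].
      by apply: complex_ext; rewrite /cexp /= expR0 cos0 sin0; ring.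
    by rewrite subrr !mul0r.
  by rewrite /cint /= /Rintegral !integral0.
have dec : expR (- (sg * n%:R)) * (sg^-1 * I) @[n --> \oo] --> 0.
  rewrite -[X in _ --> X](mul0r (sg^-1 * I)); apply: cvgM; last exact: cvg_cst.
  have -> : (fun n : nat => expR (- (sg * n%:R))) = (fun n => expR (- sg) ^+ n).
    by apply/funext => n; rewrite -expRM_natr mulNr.
  by apply: cvg_expr; rewrite ger0_norm ?expR_ge0// expR_lt1 oppr_lt0.
have lim (Q : R[i] -> R) : (forall z, `|Q z| <= cmod z) -> {morph Q : x y / x - y >-> x - y} ->
    Q (F n%:R) @[n --> \oo] --> Q L.
  move=> Qb QB; apply: cvg_zero; apply: norm_cvg0.
  apply: (@squeeze_cvgr _ _ _ _ (cst 0) _ _ _ _ _ dec).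
    by apply: nearW => n; rewrite normr_ge0 /= !fctE /= -QB (le_trans (Qb _) (F_L _)).
  exact: cvg_cst.
apply: complex_ext => /=; move: i1 => [i1 i2].
  have := @integral_halfline_lim (fun t => complex.Re (F t)) (fun t => complex.Re (f t)) (complex.Re L).
  rewrite F0 /= subr0; apply => //.
  - by move=> t _; have [] := cderive_F t.
  - by move=> t _; have [] := f_cont t.
  - by apply: (lim (@complex.Re R)); [exact: Re_le_cmod|move=> x y; rewrite cReD cReN].
have := @integral_halfline_lim (fun t => complex.Im (F t)) (fun t => complex.Im (f t)) (complex.Im L).
rewrite F0 /= subr0; apply => //.
- by move=> t _; have [] := cderive_F t.
- by move=> t _; have [] := f_cont t.
- by apply: (lim (@complex.Im R)); [exact: Im_le_cmod|move=> x y; rewrite cImD cImN].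
Qed.

End OneFrequency.

End LaplaceFourier.

(** * Lerch's theorem *)

Section Lerch.
Context {R : realType}.
Notation mu := (@lebesgue_measure R).
Notation RP := (`]0, +oo[%classic : set R).

(** Multiplying by e^(-t) raises s by 1, so a transform vanishing for s > c makes d, suitably
    weighted, orthogonal to all polynomials in e^(-t). The shift [k] absorbs the factor X in the
    induction on p X + x. *)
Lemma integral_poly_exp (d : R -> R) (c : R) (p : {poly R}) (k : nat) :
  (forall s, c < s -> mu.-integrable RP (EFin \o (fun t => expR (- (s * t)) * d t)) /\
     \int[mu]_(t in RP) (expR (- (s * t)) * d t) = 0) ->
  mu.-integrable RP (EFin \o (fun t => p.[expR (- t)] * (expR (- ((c + 1 + k%:R) * t)) * d t))) /\
  \int[mu]_(t in RP) (p.[expR (- t)] * (expR (- ((c + 1 + k%:R) * t)) * d t)) = 0.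
Proof.
move=> hd; elim/poly_ind: p k => [k|p x IH k].
  rewrite (_ : (fun t => _) = (fun=> 0)); last by apply/funext => t; rewrite horner0 mul0r.
  split; first exact: integrable0.
  by rewrite /Rintegral integral0.
have ck : c < c + 1 + k%:R by rewrite -addrA ltrDl ltr_pwDl.
have [i1 e1] := IH k.+1; have [i2 e2] := hd _ ck.
have [i3 e3] := integrable_lin 1 x i1 i2.
have E : (fun t => (p * 'X + x%:P).[expR (- t)] * (expR (- ((c + 1 + k%:R) * t)) * d t)) =
  (fun t => 1 * (p.[expR (- t)] * (expR (- ((c + 1 + k.+1%:R) * t)) * d t)) +
            x * (expR (- ((c + 1 + k%:R) * t)) * d t)).
  apply/funext => t; rewrite hornerMXaddC.
  have -> : - ((c + 1 + k.+1%:R) * t) = - t + - ((c + 1 + k%:R) * t).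
    by rewrite -addn1 natrD; ring.
  by rewrite expRD; ring.
by rewrite E; split => //; rewrite e3 e1 e2 !mulr0 addr0.
Qed.

Lemma integral_indic_itv (x y : R) : 0 < x -> x <= y ->
  mu.-integrable RP (EFin \o \1_(`[x, y])) /\
  \int[mu]_(t in RP) \1_(`[x, y]) t = y - x.
Proof.
move=> x0 xy.
have e : (\int[mu]_(t in RP) (\1_(`[x, y]) t)%:E = (y - x)%:E)%E.
  rewrite integral_indic//.
  rewrite (_ : `[x, y] `&` RP = `[x, y]%classic).
    rewrite [LHS]lebesgue_measure_itv /= lte_fin.
    by case: ltP => // yx; rewrite (le_anti (introT andP (conj xy yx))) subrr.
  apply/seteqP; split => t /=; rewrite !in_itv/= ?andbT; first by case.
  by move=> /andP[h1 h2]; rewrite h1 h2 (lt_le_trans x0).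
split; last by rewrite /Rintegral e.
apply/integrableP; split.
  by apply/measurable_EFinP; exact: measurable_indic.
under eq_integral do rewrite /= ger0_norm//.
by rewrite e ltry.
Qed.

(* If d t0 > 0, test against q(e^(-t))^n, where the polynomial q exceeds 1 near
   x0 = e^(-t0) and is at most 1 - eps on the part of [0, 1] away from x0. *)
Lemma lerch_pos (d : R -> R) (c : R) :
  (forall t, 0 < t -> {for t, continuous d}) ->
  (forall s, c < s -> mu.-integrable RP (EFin \o (fun t => expR (- (s * t)) * d t)) /\
     \int[mu]_(t in RP) (expR (- (s * t)) * d t) = 0) ->
  forall t, 0 < t -> d t <= 0.
Proof.
move=> cd hd t0 t00; rewrite leNgt; apply/negP => d0.
(* The weight at the abscissa c + 1 > c makes [w] integrable. *)
pose w t := expR (- ((c + 1) * t)) * d t.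
have w0 : 0 < w t0 by rewrite mulr_gt0// expR_gt0.
pose eta := w t0 / 2.
have eta0 : 0 < eta by rewrite divr_gt0.
have cw : {for t0, continuous w}.
  apply: cvgM; last exact: cd.
  apply: (@continuous_comp _ _ _ (fun t : R => - ((c + 1) * t)) expR); last exact: continuous_expR.
  by apply: cvgN; apply: cvgM; [exact: cvg_cst|exact: cvg_id].
have [de de0 hde] : exists2 e : R, 0 < e & forall t, `|t - t0| < e -> eta <= w t.
  have : \forall t \near t0, eta <= w t.
    near=> t; apply: ltW; near: t; apply: (cvgr_gt (w t0)) => //.
    by rewrite /eta; lra.
  move=> /nbhs_ballP[e /= e0 he]; exists e => // t ht; apply: he.
  by rewrite /ball/= distrC.
pose x0 := expR (- t0).
have x00 : 0 < x0 by exact: expR_gt0.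
have x01 : x0 < 1 by rewrite expR_lt1 oppr_lt0.
pose del := Num.min (x0 - expR (- (t0 + de))) (expR (- (t0 - de)) - x0).
have del0 : 0 < del.
  by rewrite lt_min !subr_gt0 !ltr_expR; apply/andP; split; lra.
have delx : del < x0.
  rewrite gt_min; apply/orP; left; rewrite ltrBlDr ltrDl; exact: expR_gt0.
have near0 t : `|expR (- t) - x0| < del -> eta <= w t.
  rewrite lt_min !ltr_norml => /andP[/andP[h1 _] /andP[_ h2]].
  apply: hde; rewrite ltr_norml.
  have : - (t0 + de) < - t by rewrite -ltr_expR; move: h1; lra.
  have : - t < - (t0 - de) by rewrite -ltr_expR; move: h2; lra.
  by move=> ? ?; apply/andP; split; lra.
(* With q = 1 + eps - (x - x0)^2, this value gives q <= 1 - eps for |x - x0| >= del and q >= 1 for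
   |x - x0| <= del / 2. *)
pose eps := del ^+ 2 / 2.
have eps0 : 0 < eps by rewrite divr_gt0// exprn_gt0.
have eps1 : eps < 1 by rewrite /eps expr2; nra.
pose q : {poly R} := (1 + eps)%:P - ('X - x0%:P) ^+ 2.
have qE x : q.[x] = 1 + eps - (x - x0) ^+ 2 by rewrite /q !hornerE.
(* On [t0, t1] the variable e^(-t) runs through [x0 - del / 2, x0], where q >= 1 and [w] >= eta. *)
pose t1 := - ln (x0 - del / 2).
have xd0 : 0 < x0 - del / 2 by lra.
have t01 : t0 < t1.
  rewrite /t1 ltrNr -ltr_expR lnK ?posrE// -/x0; lra.
pose W := \int[mu]_(t in RP) `|w t|.
have c1 : c < c + 1 by rewrite ltrDl.
have [iw _] := hd _ c1.
have iaw : mu.-integrable RP (EFin \o (fun t => `|w t|)).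
  by have := integrable_abse iw; apply: eq_integrable => // t _ /=.
have [i1 e1] := integral_indic_itv t00 (ltW t01).
(* The integral of q^n w vanishes, and its integrand is at least eta on [t0, t1] and at least -(1 -
   eps)^n |w| everywhere. *)
have key n : eta * (t1 - t0) <= (1 - eps) ^+ n * W.
  have [i2 e2] := integral_poly_exp (q ^+ n) 0 hd.
  have [i3 e3] := integrable_lin eta (- (1 - eps) ^+ n) i1 iaw.
  rewrite -subr_le0 -mulNr -e1 -e3 -[leRHS]e2; apply: le_Rintegral => // t.
  rewrite /= in_itv/= andbT => tpos; rewrite addr0 -/(w t) horner_exp qE.
  set x := expR (- t).
  have xx0 : 0 < x by exact: expR_gt0.
  have xx1 : x < 1 by rewrite expR_lt1 oppr_lt0.
  have sq1 : (x - x0) ^+ 2 <= 1 by rewrite expr2; nra.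
  have qpos : 0 <= 1 + eps - (x - x0) ^+ 2 by lra.
  (* Inside the window [w] is positive, so the transition zone, where q may lie on either side of 1,
     contributes with the right sign. *)
  have [xin|xout] := ltP `|x - x0| del.
    have wt := near0 t xin.
    have wt0 : 0 <= w t by rewrite (le_trans (ltW eta0)).
    have e0 : 0 <= (1 - eps) ^+ n * `|w t| by rewrite mulr_ge0// exprn_ge0//; lra.
    rewrite mulNr lerBlDr (@le_trans _ _ ((1 + eps - (x - x0) ^+ 2) ^+ n * w t)) ?lerDl//.
    rewrite indicE; case: (boolP (t \in _)) => tin; last first.
      by rewrite mulr0 mulr_ge0// exprn_ge0.
    rewrite mulr1; move: tin; rewrite inE/= in_itv/= => /andP[h1 h2].
    have xle : x <= x0 by rewrite ler_expR lerN2.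
    have xge : x0 - del / 2 <= x.
      by rewrite -(lnK xd0) ler_expR -lerN2 opprK.
    have q1 : 1 <= 1 + eps - (x - x0) ^+ 2.
      rewrite -addrA lerDl subr_ge0 /eps !expr2; nra.
    rewrite (le_trans wt)// -[leLHS]mul1r ler_wpM2r//.
    exact: exprn_ege1.
  have tout : (t \in `[t0, t1]%classic) = false.
    apply/negbTE/negP; rewrite inE/= in_itv/= => /andP[h1 h2].
    have xle : x <= x0 by rewrite ler_expR lerN2.
    have xge : x0 - del / 2 <= x.
      by rewrite -(lnK xd0) ler_expR -lerN2 opprK.
    move: xout; rewrite leNgt => /negP; apply.
    by rewrite ltr_norml; apply/andP; split; lra.
  have sq2 : del ^+ 2 <= (x - x0) ^+ 2.
    by rewrite -[leRHS]real_normK ?num_real// ler_pXn2r ?nnegrE ?(ltW del0).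
  rewrite indicE tout mulr0 add0r.
  set Q := (1 + eps - _) in qpos *.
  have Q1 : Q <= 1 - eps by rewrite /Q; move: sq2; rewrite /eps; lra.
  have Qn : Q ^+ n <= (1 - eps) ^+ n by rewrite lerXn2r// ?nnegrE//; lra.
  rewrite mulNr lerNl -mulrN.
  apply: (@le_trans _ _ (Q ^+ n * `|w t|)).
    rewrite ler_wpM2l ?exprn_ge0//.
    by rewrite -normrN ler_norm.
  by rewrite ler_wpM2r.
have : (1 - eps) ^+ n * W @[n --> \oo] --> 0.
  rewrite -[X in _ --> X](mul0r W); apply: cvgM; last exact: cvg_cst.
  by apply: cvg_expr; rewrite ger0_norm; lra.
have pos : 0 < eta * (t1 - t0) by rewrite mulr_gt0// subr_gt0.
move=> /(cvgr_lt 0)/(_ _ pos)[N _ /(_ N (leqnn N))] /=.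
by rewrite ltNge key.
Unshelve. all: by end_near. Qed.

Theorem lerch (d : R -> R) (c : R) :
  (forall t, 0 < t -> {for t, continuous d}) ->
  (forall s, c < s -> mu.-integrable RP (EFin \o (fun t => expR (- (s * t)) * d t)) /\
     \int[mu]_(t in RP) (expR (- (s * t)) * d t) = 0) ->
  forall t, 0 < t -> d t = 0.
Proof.
move=> cd hd t t0; apply/eqP; rewrite eq_le (lerch_pos cd hd)//=.
rewrite -oppr_le0; apply: (@lerch_pos (fun t => - d t) c) => // u.
  by move=> u0; apply: cvgN; exact: cd.
move=> cu; have [i e] := hd u cu.
have [i1 e1] := integrable_lin (-1) 0 i i.
have E : (fun t => expR (- (u * t)) * - d t) =
    (fun t => -1 * (expR (- (u * t)) * d t) + 0 * (expR (- (u * t)) * d t)).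
  by apply/funext => v; ring.
by rewrite E e1 e !mulr0 addr0.
Qed.

End Lerch.

(** * The inverse transform *)

Section Inversion.
Context {R : realType}.
Implicit Types (nu a c r x y t m p : R).
Notation mu := (@lebesgue_measure R).
Notation RP := (`]0, +oo[%classic : set R).

(** Real values of s suffice: there e^(-st) is real, so the transform splits into those of the real
    and imaginary parts, and Lerch's theorem applies to each difference. *)
Lemma laplace_inverse_unique (F : R[i] -> R[i]) (y1 y2 : R -> R[i]) :
  is_inverse_laplace F y1 -> is_inverse_laplace F y2 ->
  forall t, 0 < t -> y1 t = y2 t.
Proof.
move=> [cy1 [c1 h1]] [cy2 [c2 h2]] t t0.
have LE (y : R -> R[i]) s u : laplace_integrand y s%:C u = (expR (- (s * u)))%:C * y u.
  congr (_ * _); apply: complex_ext; rewrite /cexp /= !(mulr0, mul0r, subr0, addr0, oppr0).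
    by rewrite cos0 mulr1.
  by rewrite sin0 mulr0.
have main (P : R[i] -> R) : (forall x z, P (x%:C * z) = x * P z) ->
    (forall s, P (laplace y1 s) = \int[mu]_(u in RP) P (laplace_integrand y1 s u)) ->
    (forall s, P (laplace y2 s) = \int[mu]_(u in RP) P (laplace_integrand y2 s u)) ->
    (forall u, 0 < u -> {for u, continuous (fun u => P (y1 u))}) ->
    (forall u, 0 < u -> {for u, continuous (fun u => P (y2 u))}) ->
    (forall s, c1 < complex.Re s -> mu.-integrable RP (EFin \o (fun u => P (laplace_integrand y1 s u)))) ->
    (forall s, c2 < complex.Re s -> mu.-integrable RP (EFin \o (fun u => P (laplace_integrand y2 s u)))) ->
    P (y1 t) = P (y2 t).
  move=> PZ P1 P2 C1 C2 I1 I2.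
  apply/eqP; rewrite -subr_eq0; apply/eqP.
  apply: (@lerch _ (fun t => P (y1 t) - P (y2 t)) (Num.max c1 c2)) => //.
    by move=> u u0; apply: cvgB; [exact: C1|exact: C2].
  move=> s; rewrite gt_max => /andP[s1 s2].
  have [i e] := integrable_lin 1 (-1) (I1 s%:C s1) (I2 s%:C s2).
  have E : (fun u => expR (- (s * u)) * (P (y1 u) - P (y2 u))) =
     (fun u => 1 * P (laplace_integrand y1 s%:C u) + -1 * P (laplace_integrand y2 s%:C u)).
    by apply/funext => u; rewrite !LE !PZ; ring.
  rewrite E e -P1 -P2; split => //.
  by rewrite (h1 s%:C s1).2 (h2 s%:C s2).2; ring.
apply: complex_ext; apply: main => //.
- by move=> x z; rewrite cReRM.
- by move=> u u0; have [] := cy1 u u0.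
- by move=> u u0; have [] := cy2 u u0.
- by move=> s hs; have [[]] := h1 s hs.
- by move=> s hs; have [[]] := h2 s hs.
- by move=> x z; rewrite cImRM.
- by move=> u u0; have [] := cy1 u u0.
- by move=> u u0; have [] := cy2 u u0.
- by move=> s hs; have [[]] := h1 s hs.
- by move=> s hs; have [[]] := h2 s hs.
Qed.

Lemma polar_carg (s : R[i]) : 0 < complex.Re s ->
  s = zpol (cmod s) (carg s) /\ - (pi / 2) < carg s < pi / 2.
Proof.
move=> s0; have pi0 := @pi_gt0 R.
have m0 : 0 < cmod s by rewrite (lt_le_trans s0)// (le_trans (ler_norm _))// Re_le_cmod.
pose x := complex.Re s / cmod s.
have x0 : 0 < x by rewrite divr_gt0.
have x1 : x <= 1 by rewrite ler_pdivrMr// mul1r (le_trans (ler_norm _))// Re_le_cmod.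
have xI : -1 <= x <= 1 by rewrite x1 (le_trans _ (ltW x0))// lerN10.
have mx : cmod s * x = complex.Re s by rewrite mulrC divfK// gt_eqF.
have A0 : 0 <= acos x by exact: acos_ge0.
have A1 : acos x < pi / 2.
  rewrite ltNge; apply/negP => h.
  have := le_cos (ltW (divr_gt0 pi0 (ltr0Sn R 1))) h (acos_lepi xI).
  by rewrite cos_pihalf acosK ?in_itv//= leNgt x0.
have ms : cmod s * sin (acos x) = `|complex.Im s|.
  rewrite sin_acos// -(ger0_norm (ltW m0)) -sqrtr_sqr -sqrtrM ?sqr_ge0//.
  rewrite mulrBr mulr1 -exprMn mx sqr_cmod.
  by rewrite addrAC subrr add0r sqrtr_sqr.
have car : carg s = if 0 <= complex.Im s then acos x else - acos x by [].
split; last first.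
  by rewrite car; case: ifP => _; apply/andP; split; lra.
rewrite /zpol cisE; apply: complex_ext; rewrite ?cReRM ?cImRM /= car; case: ifPn => h.
- by rewrite acosK ?mx// in_itv.
- by rewrite cosN acosK ?mx// in_itv.
- by rewrite ms ger0_norm.
- by rewrite sinN mulrN ms ltr0_norm ?opprK// ltNge.
Qed.

(* 1 / (2 pi i) int e^(tz) F(z) dz along the imaginary axis, the contributions of
   the two half-lines being complex conjugate. *)
Definition bromwich nu a t : R :=
  1 / pi * \int[mu]_(r in RP) complex.Re (cis (t * r) * estr nu a r (pi / 2)).

(** On the imaginary axis dz = i dr, which turns the real part into an imaginary part. After the
    quarter turn dz = -dr, and this sign cancels that of the sine in exp(-a x^nu e^(i pi nu)). *)
Lemma bromwichE nu a t : 0 < nu -> nu <= 1 / 2 -> 0 < a -> 0 < t ->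
  bromwich nu a t = 1 / pi * \int[mu]_(x in RP)
    (expR (- (t * x)) * expR (- (a * cos (pi * nu) * x `^ nu)) * sin (a * sin (pi * nu) * x `^ nu)).
Proof.
move=> nu0 nu1 a0 t0.
have h : \int[mu]_(r in RP) complex.Im (cis pi * (cexp (t%:C * zpol r pi) * estr nu a r pi)) =
    \int[mu]_(r in RP) complex.Im (cis (pi / 2) * (cexp (t%:C * zpol r (pi / 2)) * estr nu a r (pi / 2)))
  := congr1 (@complex.Im R) (ray_rotation nu0 nu1 a0 t0).
rewrite /bromwich; congr (_ * _).
transitivity (\int[mu]_(r in RP) complex.Im (cis (pi / 2) * (cexp (t%:C * zpol r (pi / 2)) * estr nu a r (pi / 2)))).
  apply: eq_Rintegral => r _.
  have -> : cexp (t%:C * zpol r (pi / 2)) = cis (t * r).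
    rewrite -cexp_imag; congr cexp; rewrite /zpol cisE cos_pihalf sin_pihalf; apply: complex_ext => /=; ring.
  by rewrite [in RHS]cisE cos_pihalf sin_pihalf [in RHS]cImM /=; ring.
rewrite -h; apply: eq_Rintegral => r _.
have -> : t%:C * zpol r pi = (- (t * r))%:C.
  by rewrite /zpol cisE cospi sinpi; apply: complex_ext => /=; ring.
rewrite cisE cospi sinpi estrE /cexp /= cos0 sin0 sinN.
have -> : a * (r `^ nu * cos (nu * pi)) = a * cos (pi * nu) * r `^ nu by rewrite (mulrC pi); ring.
have -> : a * (r `^ nu * sin (nu * pi)) = a * sin (pi * nu) * r `^ nu by rewrite (mulrC pi); ring.
ring.
Qed.

End Inversion.

(** * The integral along the imaginary axis inverts F *)

Section BromwichLaplace.
Context {R : realType}.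
Implicit Types (nu a c r x y t m p : R).
Notation mu := (@lebesgue_measure R).
Notation RP := (`]0, +oo[%classic : set R).

Lemma estr_ray_bd nu a : 0 < nu -> nu <= 1 / 2 -> 0 < a ->
  exists C, forall r th, 0 < r -> - (pi / 2) <= th <= pi / 2 ->
    cmod (estr nu a r th) <= cauchy_bd C r.
Proof.
move=> nu0 nu1 a0; have pi0 := @pi_gt0 R.
have c0 : 0 < a * cos (pi / 4) by rewrite mulr_gt0// cos_gt0_pihalf//; lra.
have [C _ hC] := stretched_exp_bd nu0 c0.
exists C => r th r0 hth; rewrite (le_trans (cmod_estr_le nu0 nu1 a0 r0 hth))//.
by rewrite (le_trans _ (hC r r0))// ler_peMl ?expR_ge0// lerDl ltW.
Qed.

Lemma cint_conj (f g : R -> R[i]) : cintegrable f ->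
  (forall r, complex.Re (g r) = complex.Re (f r)) ->
  (forall r, complex.Im (g r) = - complex.Im (f r)) ->
  cint f + cint g = (2 * \int[mu]_(r in RP) complex.Re (f r))%:C.
Proof.
move=> [i1 i2] gR gI.
have e : \int[mu]_(r in RP) complex.Im (g r) = - \int[mu]_(r in RP) complex.Im (f r).
  have [_ e2] := integrable_lin (-1) 0 i2 i2.
  transitivity (\int[mu]_(r in RP) (-1 * complex.Im (f r) + 0 * complex.Im (f r))).
    by apply: eq_Rintegral => r _; rewrite gI; ring.
  by rewrite e2; ring.
have e1 : \int[mu]_(r in RP) complex.Re (g r) = \int[mu]_(r in RP) complex.Re (f r).
  by apply: eq_Rintegral => r _; rewrite gR.
by apply: complex_ext; rewrite /cint /= ?e ?e1; ring.
Qed.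

(** Each half-line contributes to the transform an integral of F against 1 / (s - z). Multiplied by
    i and -i these are the ray integrals [hray] at pi/2 and -pi/2, so i times the sum of the
    contributions is the jump 2 pi i F(s). *)
Lemma bromwich_inverse_laplace nu a : 0 < nu -> nu <= 1 / 2 -> 0 < a ->
  is_inverse_laplace (fun s => cexp (- (a%:C * cpow s nu))) (fun t => (bromwich nu a t)%:C).
Proof.
move=> nu0 nu1 a0; have pi0 := @pi_gt0 R.
have [C hC] := estr_ray_bd nu0 nu1 a0.
pose wp r := estr nu a r (pi / 2); pose wm r := estr nu a r (- (pi / 2)).
have cont th r : 0 < r -> ccontinuous_at (fun r => estr nu a r th) r.
  by move=> r0; have [_ h] := phol_continuous (phol_estr nu a th r0).
have wpC r : 0 < r -> cmod (wp r) <= cauchy_bd C r.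
  by move=> r0; apply: hC => //; apply/andP; split; lra.
have wmC r : 0 < r -> cmod (wm r) <= cauchy_bd C r.
  by move=> r0; apply: hC => //; apply/andP; split; lra.
have cwp r : 0 < r -> ccontinuous_at wp r by exact: cont.
have cwm r : 0 < r -> ccontinuous_at wm r by exact: cont.
have ccis e t r : ccontinuous_at (fun r => cis (e * (t * r))) r.
  have -> : (fun u => cis (e * (t * u))) = (fun u => cis (e * t * u)) :> (R -> R[i]).
    by apply/funext => u; rewrite mulrA.
  exact: cderive_continuous (cderive_cis _ _).
pose gp t r := cis (1 * (t * r)) * wp r.
pose gm t r := cis (-1 * (t * r)) * wm r.
have igp t : cintegrable (gp t).
  apply: (@cintegrable_bd _ _ C) => r r0; last by rewrite cmodM cmod_cis mul1r wpC.
  by apply: ccontinuousM; [exact: ccis|exact: cwp].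
have yE : bromwich nu a = fun t => 1 / pi * \int[mu]_(r in RP) complex.Re (gp t r).
  by apply/funext => t; congr (_ * _); apply: eq_Rintegral => r _; rewrite /gp mul1r.
(* The real part is written as half the sum of two conjugate integrals, a form to which complex
   linearity of the transform applies. *)
have YE t : (bromwich nu a t)%:C = ((2 * pi)^-1)%:C * (cint (gp t) + cint (gm t)).
  rewrite (@cint_conj (gp t) (gm t))//.
  - rewrite -rmorphM/= yE; congr (_%:C); rewrite [RHS]mulrA; congr (_ * _).
    by rewrite div1r invfM mulrAC mulVf// mul1r.
  - by move=> r; rewrite /gp /gm /wp /wm !estrE /cexp !cisE /= !(mulN1r, mul1r, mulrN, sinN, cosN, opprK); ring.
  - by move=> r; rewrite /gp /gm /wp /wm !estrE /cexp !cisE /= !(mulN1r, mul1r, mulrN, sinN, cosN, opprK); ring.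
split.
  move=> t _; split; last exact: cvg_cst.
  rewrite /= yE; apply: cvgM; first exact: cvg_cst.
  apply: (@continuity_under_integral R _ _ mu (fun t r => complex.Re (gp t r)) RP _
    (t - 1) (t + 1) _ _ (cauchy_bd C)) => //.
  - by move=> y _; have [] := igp y.
  - apply: aeW => r _ y _.
    have h := cderiveM (cderive_cis r y) (cderive_cst (wp r) y).
    have [h1 _] := cderive_continuous h.
    have -> : (fun t => complex.Re (gp t r)) = (fun t => complex.Re (cis (r * t) * wp r)).
      by apply/funext => u; rewrite /gp mul1r (mulrC u).
    exact: h1.
  - exact: integrable_cauchy_bd.
  - move=> y _; apply: aeW => r rP; have r0 : 0 < r by move: rP; rewrite /= in_itv/= andbT.
    by apply: (le_trans (Re_le_cmod _)); rewrite cmodM cmod_cis mul1r wpC.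
  - by rewrite inE/= in_itv/=; apply/andP; split; lra.
(* The function is bounded, so the abscissa 0 will do. *)
exists 0 => s s0.
have [sE hal] := polar_carg s0.
have m0 : 0 < cmod s by rewrite (lt_le_trans s0)// (le_trans (ler_norm _))// Re_le_cmod.
have [ip ep] := laplace_fourier 1 cwp wpC s0.
have [im em] := laplace_fourier (-1) cwm wmC s0.
have [ipm epm] := cintD ip im.
have [iY eY] := cintZ ((2 * pi)^-1)%:C ipm.
have LE : laplace_integrand (fun t => (bromwich nu a t)%:C) s =
    (fun t => ((2 * pi)^-1)%:C * (cexp (- (s * t%:C)) * cint (gp t) + cexp (- (s * t%:C)) * cint (gm t))).
  by apply/funext => t; rewrite /laplace_integrand YE -mulrDr mulrCA.
rewrite /laplace_integrable /laplace LE; split; first exact: iY.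
transitivity (cint (fun t => ((2 * pi)^-1)%:C * (cexp (- (s * t%:C)) * cint (gp t) + cexp (- (s * t%:C)) * cint (gm t)))); first by [].
rewrite eY epm ep em.
have -> : cexp (- (a%:C * cpow s nu)) = estr nu a (cmod s) (carg s).
  by rewrite /estr /zpow /cpow cexp_imag.
have J := hray_jump nu0 nu1 a0 m0 hal; rewrite -sE in J.
have iHp : cintegrable (fun r => (s - 'i * (1 * r)%:C)^-1 * wp r)
  := cintegrable_resolvent 1 cwp wpC s0.
have iHm : cintegrable (fun r => (s - 'i * (-1 * r)%:C)^-1 * wm r)
  := cintegrable_resolvent (-1) cwm wmC s0.
have Hp : hray nu a s (pi / 2) = 'i * cint (fun r => (s - 'i * (1 * r)%:C)^-1 * wp r).
  have [_ <-] := cintZ 'i iHp; apply: eq_cint => r _.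
  have -> : zpol r (pi / 2) = 'i * (1 * r)%:C.
    by rewrite /zpol cisE cos_pihalf sin_pihalf; apply: complex_ext => /=; ring.
  by rewrite cisE cos_pihalf sin_pihalf; congr (_ * _); rewrite mulrC.
have Hm : hray nu a s (- (pi / 2)) = (- 'i) * cint (fun r => (s - 'i * (-1 * r)%:C)^-1 * wm r).
  have [_ <-] := cintZ (- 'i) iHm; apply: eq_cint => r _.
  have -> : zpol r (- (pi / 2)) = 'i * (-1 * r)%:C.
    by rewrite /zpol cisE cosN sinN cos_pihalf sin_pihalf; apply: complex_ext => /=; ring.
  have -> : cis (- (pi / 2)) = - 'i :> R[i].
    by rewrite cisE cosN sinN cos_pihalf sin_pihalf; apply: complex_ext => /=; ring.
  by congr (_ * _); rewrite mulrC.
move: J; rewrite Hp Hm mulNr opprK -mulrDr.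
have -> : 0 +i* (2 * pi) = 'i * (2 * pi)%:C :> R[i] by apply: complex_ext => /=; ring.
have i0 : 'i != 0 :> R[i] by rewrite eq_complex /= oner_eq0 andbF.
rewrite mulrCA => /(mulfI i0) ->.
rewrite mulrCA -rmorphM/= mulVf ?mulr1//.
by rewrite mulf_neq0// gt_eqF.
Qed.

End BromwichLaplace.

(** * The integral formula *)

Unset Implicit Arguments.

Theorem proposition2p4 (R : realType) (nu a : R)
    (nu_gt0 : 0 < nu) (nu_le : nu <= 1 / 2) (a_gt0 : 0 < a)
    (t : R) (t_gt0 : 0 < t) :
  let f := fun x : R => expR (- (t * x)) * expR (- (a * cos (pi * nu) * x `^ nu))
             * sin (a * sin (pi * nu) * x `^ nu) in
  lebesgue_measure.-integrable `]0, +oo[ (EFin \o f) /\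
  R0 nu a t = (1 / pi * \int[lebesgue_measure]_(x in `]0, +oo[) f x)%:C.
Proof.
move=> f; split.
  have [C C0 hC] := stretched_exp_bd (@ltr01 R) t_gt0.
  apply: (@integrable_halfline _ f C) => x x0.
    have cp : {for x, continuous (fun x : R => x `^ nu)}.
      exact: is_derive_continuous (is_derive1_powR nu x0).
    apply: cvgM; first apply: cvgM.
    - apply: (@continuous_comp _ _ _ (fun x : R => - (t * x)) expR); last exact: continuous_expR.
      by apply: cvgN; apply: cvgM; [exact: cvg_cst|exact: cvg_id].
    - apply: (@continuous_comp _ _ _ (fun x : R => - (a * cos (pi * nu) * x `^ nu)) expR); last exact: continuous_expR.
      by apply: cvgN; apply: cvgM; [exact: cvg_cst|exact: cp].
    - apply: (@continuous_comp _ _ _ (fun x : R => a * sin (pi * nu) * x `^ nu) sin); last exact: continuous_sin.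
      by apply: cvgM; [exact: cvg_cst|exact: cp].
  have pi0 := @pi_gt0 R.
  (* For nu <= 1/2 the second exponential is at most 1, so e^(-tx) alone supplies an integrable
     majorant; at nu = 1/2 no other decay is available. *)
  have c0 : 0 <= cos (pi * nu) by apply: cos_ge0_pihalf; apply/andP; split; nra.
  have e1 : expR (- (a * cos (pi * nu) * x `^ nu)) <= 1.
    by rewrite expR_le1 oppr_le0 !mulr_ge0 ?powR_ge0// ltW.
  rewrite /f !normrM !(ger0_norm (expR_ge0 _)).
  apply: (@le_trans _ _ (expR (- (t * x)) * 1 * 1)).
    by rewrite ler_pM ?mulr_ge0 ?expR_ge0 ?sin_max// ler_wpM2l ?expR_ge0.
  rewrite !mulr1 (le_trans _ (hC x x0))// powRr1 ?(ltW x0)//.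
  by rewrite ler_peMl ?expR_ge0// lerDl ltW.
have hB := bromwich_inverse_laplace nu_gt0 nu_le a_gt0.
rewrite -(bromwichE nu_gt0 nu_le a_gt0 t_gt0).
rewrite /R0 /inverse_laplace.
apply: (laplace_inverse_unique _ hB) t_gt0.
(* An inverse transform exists, so the chosen one is genuine and not the default zero function;
   uniqueness identifies its value at t. *)
by apply: (@xgetPex _ (fun=> 0) [set y | is_inverse_laplace _ y]); exists (fun u => (bromwich nu a u)%:C).
Qed.
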